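(* Let $n\geqslant 2$, let \[ g(t)=\prod_{a=1}^n(t-r_a),\qquad r_1<\cdots<r_n \text{ real}, \] and let $\xi\in(r_{n-1},r_n)$ be the largest zero of $g'$. If $1\leqslant k\leqslant n$ and $\lambda\vdash k$ is branching-balanced, then \[ \mathscr P^\lambda(t-r_1,\ldots,t-r_n)\succeq 0\qquad\text{for every real } t\geqslant\xi . \] This is sharp uniformly in $\lambda$: if $\eta<\xi$ is real, then there is a nonempty branching-balanced partition $\lambda$ with $|\lambda|\leqslant n$ such that it is not the case that $\mathscr P^\lambda(t-r_1,\ldots,t-r_n)\succeq 0$ for all $t\in[\eta,\infty)$.
   Context: Group algebra order: let $*$ be the antilinear involution on $\mathbb C[\mathfrak S_n]$ with $\sigma^*=\sigma^{-1}$. For self-adjoint $A\in\mathbb C[\mathfrak S_n]$, write $A\succeq 0$ if $\rho(A)$ is positive semidefinite in every (finite-dimensional) unitary representation $\rho$ of $\mathfrak S_n$. Partitions: $\lambda\vdash k$ means $\lambda$ is a partition of $k=|\lambda|$; $S^\lambda$ is the (complex) Specht module, $\chi^\lambda$ its character, $f^\lambda=\dim S^\lambda$ (so $S^{(k)}$ is trivial and $S^{(1^k)}$ is sign). Write $\mu\gtrdot\lambda$ if $\mu$ is obtained from $\lambda$ by adding one box. For $\lambda\vdash k$ and $\mu\gtrdot\lambda$ put $p^\uparrow(\lambda,\mu)=\frac{f^\mu}{(k+1)f^\lambda}$, and for nonempty $\lambda$ put $\vartheta(\lambda)=\max_{\mu\gtrdot\lambda}p^\uparrow(\lambda,\mu)$.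 A nonempty partition $\lambda$ is branching-balanced if $\vartheta(\lambda)\leqslant\frac12$. Universal Plücker coordinates: let $[n]=\{1,\ldots,n\}$ and for $X\subseteq[n]$ regard $\mathfrak S_X$ as the subgroup of $\mathfrak S_n$ fixing the complement of $X$. For $\mathbf u=(u_1,\ldots,u_n)\in\mathbb C^n$ and $\lambda\vdash k$ with $k\leqslant n$, \[ \mathscr P^\lambda(\mathbf u)=\sum_{\substack{X\subseteq[n]\\|X|=k}}\Bigl(\sum_{\sigma\in\mathfrak S_X}\chi^\lambda(\sigma)\sigma\Bigr)\prod_{a\in[n]\setminus X}u_a\in\mathbb C[\mathfrak S_n].\] *)

(* Defs.v *)
From HB Require Import structures.
From mathcomp Require Import all_boot all_order all_algebra all_fingroup.
From mathcomp Require Import sesquilinear spectral mxrepresentation.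
From mathcomp Require Import complex reals.
Set Implicit Arguments.
Unset Strict Implicit.
Unset Printing Implicit Defensive.
Import Order.TTheory GRing.Theory Num.Theory.
Local Open Scope ring_scope.
Local Open Scope sesquilinear_scope.

Definition is_partition_of (k : nat) (la : seq nat) : bool :=
  [&& sorted geq la, 0%N \notin la & sumn la == k].

(* The boxes of the Young diagram: row [tag c], column [tagged c]. *)
Definition cell (la : seq nat) : finType :=
  {i : 'I_(size la) & 'I_(nth 0%N la i)}.

Definition cell_col (la : seq nat) (c : cell la) : nat := tagged c.

(* The Specht module of shape [la] over [F], as a module for [Sym X] (the
   permutations of [T] that fix the complement of [X]), is the span of the
   polytabloids of the tableaux with content [X].  A tabloid is the sequence of
   the sets of entries of its rows.  Everything is a right module, as usual in
   mxrepresentation: [(s * s')%g] is [s] followed by [s']. *)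
Section Specht.

Variables (F : fieldType) (T : finType) (la : seq nat).

Definition tabloid : finType := {ffun 'I_(size la) -> {set T}}.

Definition tabloid_of (t : {ffun cell la -> T}) : tabloid :=
  [ffun i => [set t c | c : cell la & tag c == i]].

Definition tabloid_act (D : tabloid) (s : {perm T}) : tabloid :=
  [ffun i => s @: D i].

Definition tableau_act (t : {ffun cell la -> T}) (s : {perm T}) :
  {ffun cell la -> T} := [ffun c => s (t c)].

Lemma tabloid_of_act t s :
  tabloid_of (tableau_act t s) = tabloid_act (tabloid_of t) s.
Proof.
apply/ffunP=> i; rewrite !ffunE -imset_comp; apply: eq_imset => c.
by rewrite /= ffunE.
Qed.

Lemma tableau_actM t s s' :
  tableau_act (tableau_act t s) s' = tableau_act t (s * s')%g.
Proof. by apply/ffunP=> c; rewrite !ffunE permM. Qed.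

Definition tabloid_vec (D : tabloid) : 'rV[F]_#|tabloid| :=
  delta_mx 0 (enum_rank D).

Definition tabloid_mx (s : {perm T}) : 'M[F]_#|tabloid| :=
  \matrix_i tabloid_vec (tabloid_act (enum_val i) s).

Lemma tabloid_vec_act D s :
  tabloid_vec D *m tabloid_mx s = tabloid_vec (tabloid_act D s).
Proof. by rewrite -rowE rowK enum_rankK. Qed.

Lemma tabloid_mx_repr (G : {group {perm T}}) : mx_repr G tabloid_mx.
Proof.
split=> [|s s' _ _]; apply/row_matrixP=> i.
  rewrite rowK row1 /tabloid_vec; congr (delta_mx 0 _).
  rewrite -[RHS]enum_valK; congr enum_rank; apply/ffunP=> j.
  by rewrite ffunE (eq_imset _ (perm1 (T:=T))) imset_id.
rewrite row_mul !rowK tabloid_vec_act; congr tabloid_vec.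
apply/ffunP=> j; rewrite !ffunE -imset_comp.
by apply: eq_imset => x; rewrite /= permM.
Qed.

Definition tabloid_repr (G : {group {perm T}}) :=
  MxRepresentation (tabloid_mx_repr G).

Variable X : {set T}.

Definition is_tableau (t : {ffun cell la -> T}) : bool :=
  injectiveb t && ([set t c | c : cell la] == X).

Definition col_stab (t : {ffun cell la -> T}) : {set {perm T}} :=
  [set s in Sym X | [forall c, exists c',
     (cell_col c' == cell_col c) && (s (t c) == t c')]].

Definition polytabloid (t : {ffun cell la -> T}) : 'rV[F]_#|tabloid| :=
  \sum_(s in col_stab t)
     (-1) ^+ odd_perm s *: tabloid_vec (tabloid_of (tableau_act t s)).

Definition specht_mx : 'M[F]_#|tabloid| :=
  (\sum_(t : {ffun cell la -> T} | is_tableau t) <<polytabloid t>>)%MS.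

Lemma is_tableau_act t s :
  s \in Sym X -> is_tableau t -> is_tableau (tableau_act t s).
Proof.
rewrite inE => sX /andP[/injectiveP injt /eqP imt]; apply/andP; split.
  by apply/injectiveP=> c c'; rewrite !ffunE => /perm_inj/injt.
apply/eqP/setP=> x; rewrite -(im_perm_on sX) -imt.
apply/imsetP/imsetP=> [[c _ ->]|[_ /imsetP[c _ ->] ->]].
  by exists (t c); rewrite ?imset_f // ffunE.
by exists c; rewrite ?ffunE.
Qed.

Lemma col_stab_act t s p :
  s \in Sym X -> ((p ^ s)%g \in col_stab (tableau_act t s)) = (p \in col_stab t).
Proof.
move=> sX; rewrite ![in LHS]inE ![in RHS]inE.
have -> : perm_on X (p ^ s)%g = perm_on X p.
  by have := groupJr (G := Sym_group X) p sX; rewrite /= !inE.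
congr (_ && _); apply: eq_forallb => c; apply: eq_existsb => c'.
by rewrite !ffunE permJ (inj_eq perm_inj).
Qed.

Lemma polytabloid_act t s :
  s \in Sym X -> polytabloid t *m tabloid_mx s = polytabloid (tableau_act t s).
Proof.
move=> sX; rewrite mulmx_suml [RHS](reindex_inj (conjg_inj s)) /=.
apply: eq_big => [p|p _]; first by rewrite col_stab_act.
rewrite -scalemxAl tabloid_vec_act -tabloid_of_act !tableau_actM -conjgC.
by rewrite odd_permJ.
Qed.

Lemma specht_module : mxmodule (tabloid_repr (Sym_group X)) specht_mx.
Proof.
apply/mxmoduleP=> s sX; rewrite sumsmxMr; apply/sumsmx_subP=> t tX.
rewrite (eqmxMr _ (genmxE _)) polytabloid_act //.
by rewrite (sumsmx_sup (tableau_act t s)) ?genmxE ?is_tableau_act.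
Qed.

Definition specht_repr := submod_repr specht_module.

Definition specht_char (s : {perm T}) : F := \tr (specht_repr s).

End Specht.

Definition specht_dim (F : fieldType) (la : seq nat) : nat :=
  \rank (specht_mx F la [set: 'I_(sumn la)]).

Section Branching.

Variable R : realType.

Definition p_up (la mu : seq nat) : R :=
  (specht_dim R[i] mu)%:R / ((sumn la).+1%:R * (specht_dim R[i] la)%:R).

(* The partitions covering [la] are the [incr_nth la i] that are partitions,
   where necessarily [i <= size la]. *)
Definition theta (la : seq nat) : R :=
  \big[Num.max/0]_(i < (size la).+1 |
      is_partition_of (sumn la).+1 (incr_nth la i)) p_up la (incr_nth la i).

Definition branching_balanced (la : seq nat) : bool := theta la <= 2^-1.

End Branching.

(* The group algebra is the library's [group_ring], in which [s : 'S_n] is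
   [regular_repr _ _ s]; its elements act in a representation by [gring_op]. *)
Section GroupAlgebra.

Variables (R : realType) (n : nat).

Local Notation G := [set: 'S_n]%G.
Local Notation C := R[i].
Local Notation gring := 'M[C]_(gcard G).

Definition gring_coef (A : gring) (s : 'S_n) : C := @gring_proj C _ G s A 0 0.

Definition gring_star (A : gring) : gring :=
  \sum_(s : 'S_n) (gring_coef A s)^* *: regular_repr C G (s^-1)%g.

Definition psdmx (d : nat) (M : 'M[C]_d) : Prop :=
  M \is hermsymmx /\
  forall v : 'rV[C]_d, 0 <= (v *m M *m v ^t*) 0 0.

(* The first condition also forces [A] to lie in [group_ring C G]. *)
Definition gring_psd (A : gring) : Prop :=
  gring_star A = A /\
  forall (d : nat) (rho : mx_representation C G d),
    (forall s : 'S_n, rho s \is unitarymx) -> psdmx (gring_op rho A).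

Definition plucker (la : seq nat) (u : 'I_n -> C) : gring :=
  \sum_(X : {set 'I_n} | #|X| == sumn la)
     (\prod_(a in ~: X) u a) *:
       (\sum_(s in Sym X) specht_char C la X s *: regular_repr C G s).

End GroupAlgebra.

Definition largest_root (R : realType) (p : {poly R}) (x : R) : Prop :=
  root p x /\ forall y : R, root p y -> y <= x.

(* Main.v *)
(* Put [u_c = t - r_c] and [E_X = \sum_(s in Sym X) chi(s) s], a positive multiple
   of a projection.  Between [xi] and [r_n] exactly one [u_c] is negative and
   [\sum_c 1 / u_c <= 0]; dividing by the product of the positive ones, the
   positivity of the Plücker coordinate reduces, monomial by monomial, to
     [\sum_(c in Y) E_(Y - c) >= 2 E_(Y - b)]  for [#|Y| = k + 1] and [b \in Y].
   By the branching rule the left side is [\sum_(mu covers la) E^mu_Y]; it acts on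
   the [mu]-isotypic part by [(k + 1)! / f_mu], whereas [E_(Y - b)] is [k! / f_la]
   times a projection supported on those parts, so the inequality says exactly
   that [f_mu / ((k + 1) f_la) <= 1 / 2].  Sharpness is seen on [la = (1)], whose
   Plücker coordinate is the scalar [g'(t)], negative just below [xi].

   The branching rule comes from counting.  Polytabloids give Schur's lemma for
   Specht modules and a nonzero map [S^mu -> S^la] whenever [mu] covers [la]; so
   [f_la] is at least the number of standard tableaux of shape [la].  The squares
   of these numbers add up to [k!], while Bessel's inequality for the orthonormal
   characters bounds the sum of the [f_la ^ 2] by [k!]; hence equality, and the
   Specht modules exhaust the group algebra. *)
Require Import Defs.
From HB Require Import structures.
From mathcomp Require Import all_boot all_order all_algebra all_fingroup.
From mathcomp Require Import sesquilinear spectral mxrepresentation.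
From mathcomp Require Import complex reals.
From mathcomp Require Import zify ring lra.
Set Implicit Arguments.
Unset Strict Implicit.
Unset Printing Implicit Defensive.

(** * Partitions and standard tableaux *)

(** Why the constant is 2: let [w] be minus the negative weight and [V] the sum of the inverses of
    the positive ones, so that the condition on [t] reads [w * V <= 1]. It allows the part with [b]
    in [X] to be replaced by [w * V] times itself, and its terms are matched with those of the part
    without [b] by exchanging [b] with another point. On the monomial of such an [X] this leaves the
    sum of [E_(Y - c)] over [c] in [X] minus one [E_X], where [Y = b |: X]. Extending the sum to all
    [c] in [Y] costs a second [E_X].

    Why dimensions and branching are proved together: positivity needs the branching rule as an
    equality, whereas explicit maps only bound multiplicities from below. Completeness in degree [k]
    writes the dimension of [S^mu], with [mu] of size [k + 1], as a sum of dimensions times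
    multiplicities. The lower bounds then give the dimension bound in degree [k + 1], where the sum
    of squares leaves no slack; the same absence of slack pins down the multiplicities. *)

Local Notation part_nth := (nth 0%N).

Lemma sorted_geqP (la : seq nat) :
  reflect (forall r, part_nth la r.+1 <= part_nth la r) (sorted geq la).
Proof.
apply: (iffP (sortedP 0%N)) => [H r|H r _]; last exact: H.
case: (ltnP r.+1 (size la)) => [|h]; first exact: H.
by rewrite nth_default.
Qed.

Lemma part_nth_gt0 k la r :
  is_partition_of k la -> (0 < part_nth la r) = (r < size la).
Proof.
case/and3P=> _ nz _; case: (ltnP r) => h; last by rewrite nth_default.
by rewrite lt0n; apply: contraNneq nz => <-; rewrite mem_nth.
Qed.

Lemma part_nth_anti k la i j :
  is_partition_of k la -> i <= j -> part_nth la j <= part_nth la i.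
Proof.
case/and3P=> /sorted_geqP H _ _ /subnKC <-; elim: (j - i) => [|d IH].
  by rewrite addn0.
by rewrite addnS (leq_trans (H _)).
Qed.

Lemma part_eq k l la mu : is_partition_of k la -> is_partition_of l mu ->
  (forall r, part_nth la r = part_nth mu r) -> la = mu.
Proof.
move=> pl pm E; apply: (@eq_from_nth _ 0) => [|i _]; last exact: E.
have H r : (r < size la) = (r < size mu).
  by rewrite -(part_nth_gt0 _ pl) E (part_nth_gt0 _ pm).
by apply/eqP; rewrite eqn_leq leqNgt H ltnn leqNgt -H ltnn.
Qed.

Lemma sumn_incr_nth la i : sumn (incr_nth la i) = (sumn la).+1.
Proof.
elim: la i => [|x la IH] i; first by case: i => [|i] /=; rewrite ?addn0 //; elim: i.
by case: i => //= i; rewrite IH addnS.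
Qed.

Lemma incr_nth_partition k la i : is_partition_of k la -> i <= size la ->
  is_partition_of k.+1 (incr_nth la i) =
    (i == 0) || (part_nth la i < part_nth la i.-1).
Proof.
move=> pl ile; case/and3P: (pl) => /sorted_geqP so nz /eqP <-.
rewrite /is_partition_of sumn_incr_nth eqxx andbT.
have -> : 0 \notin incr_nth la i.
  apply/negP => /(nthP 0) [r]; rewrite size_incr_nth nth_incr_nth.
  move=> rlt /eqP; rewrite addn_eq0 eqb0 => /andP[/eqP ir /eqP z].
  have := part_nth_gt0 r pl; rewrite z ltnn; move: rlt.
  by case: (ltnP i) => hi; lia.
rewrite andbT; apply/sorted_geqP/idP => [H|H r].
  by case: i ile H => //= i ile /(_ i); rewrite !nth_incr_nth eqxx; case: eqP; lia.
rewrite !nth_incr_nth; have := so r; case: i ile H => [|i] _ /= H; first lia.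
by rewrite eqSS; case: (eqVneq i r) H => [->|_]; lia.
Qed.

(** Rows up to [size la] suffice, as a box placed further down would leave an empty row above it.
    That the result is a partition is imposed separately. *)
Definition covers (la mu : seq nat) : bool :=
  has (fun i => mu == incr_nth la i) (iota 0 (size la).+1).

Lemma coversP k la mu : is_partition_of k la -> is_partition_of k.+1 mu ->
  reflect (exists i, forall r, part_nth mu r = part_nth la r + (r == i))
          (covers la mu).
Proof.
move=> pl pm; apply: (iffP hasP) => [[i _ /eqP ->]|[i H]].
  by exists i => r; rewrite nth_incr_nth addnC eq_sym.
have ile : i <= size la.
  rewrite leqNgt; apply/negP => h; have := H i; have := H i.-1.
  have := part_nth_anti pm (leq_pred i); rewrite eqxx.
  rewrite (nth_default _ (_ : size la <= i.-1)); last lia.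
  by case: eqP; lia.
exists i; first by rewrite mem_iota.
have pi : is_partition_of k.+1 (incr_nth la i).
  rewrite incr_nth_partition //; case: i H {ile} => //= i H.
  have := part_nth_anti pm (leqnSn i); have := H i; have := H i.+1.
  by rewrite eqxx; case: eqP; lia.
by apply/eqP/(part_eq pm pi) => r; rewrite H nth_incr_nth addnC eq_sym.
Qed.

(** The filter discards the zero that appears when the removed box was a whole row. *)
Definition decr_nth la i :=
  filter (predC1 0) (mkseq (fun r => part_nth la r - (r == i)) (size la)).

Lemma nth_filter_nz s r :
  sorted geq s -> part_nth (filter (predC1 0) s) r = part_nth s r.
Proof.
elim: s r => //= x s IH r so; have := IH _ (path_sorted so).
case: x so => [|x] so H /=; last by case: r.
rewrite H; move/order_path_min: so => /(_ (rev_trans leq_trans)) /allP h.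
have h' j : part_nth s j = 0.
  case: (ltnP j (size s)) => [/(mem_nth 0) /h|]; last exact: nth_default.
  by rewrite /geq /= leqn0 => /eqP.
by case: r {H} => [|r] /=; rewrite !h'.
Qed.

Lemma sumn_filter_nz s : sumn (filter (predC1 0) s) = sumn s.
Proof. by elim: s => //= -[|x] s /= ->. Qed.

Lemma decr_nth_partition k la i : is_partition_of k.+1 la ->
    part_nth la i.+1 < part_nth la i ->
  is_partition_of k (decr_nth la i) /\
  (forall r, part_nth (decr_nth la i) r = part_nth la r - (r == i)).
Proof.
move=> pl lt; case/and3P: (pl) => /sorted_geqP so nz /eqP sm.
have ils : i < size la.
  by rewrite ltnNge; apply/negP => h; rewrite [X in _ < X]nth_default in lt.
set s := mkseq (fun r => part_nth la r - (r == i)) (size la).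
have ns r : part_nth s r = part_nth la r - (r == i).
  case: (ltnP r (size la)) => h; first by rewrite nth_mkseq.
  by rewrite !nth_default ?size_mkseq.
have ss : sorted geq s.
  apply/sorted_geqP => r; rewrite !ns; have := so r; have := lt.
  by case: (eqVneq r i) => [->|]; case: eqP; lia.
have nd r : part_nth (decr_nth la i) r = part_nth la r - (r == i).
  by rewrite nth_filter_nz.
split=> //; rewrite /is_partition_of.
have -> : sorted geq (decr_nth la i).
  by apply: sorted_filter ss; apply: rev_trans leq_trans.
rewrite mem_filter /= sumn_filter_nz; apply/eqP.
have E : incr_nth s i = la.
  apply: (@eq_from_nth _ 0) => [|r _].
    by rewrite size_incr_nth size_mkseq ils.
  rewrite nth_incr_nth ns eq_sym; have := lt.
  by case: (eqVneq r i) => [->|]; lia.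
by have := sumn_incr_nth s i; rewrite E sm => -[].
Qed.

(** A shape is produced once from each shape below it, hence [undup]. *)
Fixpoint parts (k : nat) : seq (seq nat) :=
  if k is k'.+1 then
    undup [seq mu <- [seq incr_nth la i | la <- parts k',
                                          i <- iota 0 (size la).+1]
          | is_partition_of k mu]
  else [:: [::]].

Lemma parts_uniq k : uniq (parts k).
Proof. by case: k => // k; apply: undup_uniq. Qed.

Lemma mem_parts k la : (la \in parts k) = is_partition_of k la.
Proof.
elim: k la => [|k IH] la.
  rewrite inE; apply/eqP/idP => [->//|/and3P[_ nz /eqP s0]].
  by case: la nz s0 => // -[|x] la //=; rewrite inE.
rewrite [parts _.+1]/(undup _) mem_undup mem_filter andbC.
case pl: is_partition_of; last by rewrite andbF.
rewrite andbT; apply/allpairsPdep.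
have sz : 0 < size la.
  by case: la pl => // /and3P[].
(* The last box of the last row is always removable, so every partition is reached. *)
have lt : part_nth la (size la).-1.+1 < part_nth la (size la).-1.
  by rewrite nth_default ?(part_nth_gt0 _ pl) prednK.
have [pd nd] := decr_nth_partition pl lt.
exists (decr_nth la (size la).-1).
have : covers (decr_nth la (size la).-1) la.
  apply/(coversP pd pl); exists (size la).-1 => r; rewrite nd.
  by move: lt; case: (eqVneq r (size la).-1) => [->|]; lia.
by case/hasP=> i i1 /eqP E; exists i; split=> //; rewrite IH.
Qed.

(** The number of standard Young tableaux of shape [mu], a partition of [k]: the largest entry
    occupies a removable box. *)
Fixpoint num_syt (k : nat) (mu : seq nat) : nat :=
  if k is k'.+1 then \sum_(la <- parts k' | covers la mu) num_syt k' la else 1.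

Arguments parts : simpl never.
Arguments num_syt : simpl never.

Lemma num_sytS k mu :
  num_syt k.+1 mu = \sum_(la <- parts k | covers la mu) num_syt k la.
Proof. by []. Qed.

(** Row 0 always accepts a box, and row [i + 1] accepts one exactly when row [i] can lose one. *)
Lemma count_ups k la : is_partition_of k la ->
  count (covers la) (parts k.+1) =
  (count (fun i => part_nth la i.+1 < part_nth la i) (iota 0 (size la))).+1.
Proof.
move=> pl; rewrite -size_filter.
set P := fun i => (i == 0) || (part_nth la i < part_nth la i.-1).
have -> : size (filter (covers la) (parts k.+1)) =
    size [seq incr_nth la i | i <- iota 0 (size la).+1 & P i].
  apply/perm_size/uniq_perm.
  - exact/filter_uniq/parts_uniq.
  - rewrite map_inj_uniq ?filter_uniq ?iota_uniq // => i j E.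
    apply/eqP; have := congr1 (fun s => part_nth s i) E.
    by rewrite !nth_incr_nth eqxx eq_sym => /addIn; case: eqP.
  move=> mu; rewrite mem_filter mem_parts; apply/andP/mapP.
    case=> /hasP[i ii /eqP ->].
    rewrite incr_nth_partition //; last by rewrite mem_iota in ii.
    by move=> h; exists i; rewrite ?mem_filter ?ii ?andbT.
  case=> i; rewrite mem_filter => /andP[h ii] ->; split.
    by apply/hasP; exists i.
  by rewrite incr_nth_partition //; rewrite mem_iota in ii.
rewrite size_map size_filter /= add1n; congr _.+1.
by rewrite (iotaDl 1 0) count_map; apply: eq_count => i.
Qed.

Lemma count_downs k la : is_partition_of k.+1 la ->
  count (covers^~ la) (parts k) =
  count (fun i => part_nth la i.+1 < part_nth la i) (iota 0 (size la)).
Proof.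
move=> pl; rewrite -!size_filter; set s := filter _ (iota _ _).
rewrite -(size_map (decr_nth la)).
have sP i : i \in s = (part_nth la i.+1 < part_nth la i).
  rewrite mem_filter mem_iota /= add0n -(part_nth_gt0 _ pl).
  by case: ltnP => // h; rewrite (leq_ltn_trans _ h).
apply/perm_size/uniq_perm; first exact/filter_uniq/parts_uniq.
  rewrite map_inj_in_uniq ?filter_uniq ?iota_uniq // => i j.
  rewrite !sP => hi hj E; apply/eqP.
  have [_ ni] := decr_nth_partition pl hi; have [_ nj] := decr_nth_partition pl hj.
  have := congr1 (fun s => part_nth s i) E; rewrite ni nj eqxx; move: hi.
  by case: eqP; lia.
move=> ka; rewrite mem_filter mem_parts; apply/andP/mapP.
  case=> ck pk; case/(coversP pk pl): (ck) => i H.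
  have hi : part_nth la i.+1 < part_nth la i.
    by rewrite !H eqxx; have := part_nth_anti pk (leqnSn i); case: eqP; lia.
  have [pd nd] := decr_nth_partition pl hi.
  exists i; rewrite ?sP //; apply: (part_eq pk pd) => r.
  by rewrite nd H addnK.
case=> i; rewrite sP => hi ->; have [pd nd] := decr_nth_partition pl hi.
split=> //; apply/(coversP pd pl); exists i => r; rewrite nd.
by move: hi; case: (eqVneq r i) => [->|]; lia.
Qed.

Lemma count_uniq_has (T : eqType) (p : pred T) s : uniq s ->
  {in s &, forall x y, p x -> p y -> x = y} -> count p s = has p s.
Proof.
elim: s => //= x s IH /andP[xs us] H; rewrite IH //; last first.
  by move=> y z ys zs; apply: H; rewrite inE ?ys ?zs orbT.
case px: (p x) => //=; case: hasP => // -[y ys py].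
by case/negP: xs; rewrite (H x y) // inE ?eqxx ?ys ?orbT.
Qed.

(* [DU - UD = 1] in Young's lattice. *)
Lemma count_ups_downs k la nu :
    is_partition_of k.+1 la -> is_partition_of k.+1 nu ->
  count (fun mu => covers la mu && covers nu mu) (parts k.+2) =
  count (fun ka => covers ka la && covers ka nu) (parts k) + (la == nu).
Proof.
move=> pl pn; case: (eqVneq la nu) => [<-|ne].
  rewrite addn1.
  rewrite (eq_count (a2 := covers la)); last by move=> mu; rewrite andbb.
  rewrite (count_ups pl) -(count_downs pl); congr _.+1.
  by apply: eq_count => ka; rewrite andbb.
have neP i : ~ (forall r, part_nth la r + (r == i) = part_nth nu r + (r == i)).
  by move=> H; case/eqP: ne; apply: (part_eq pl pn) => r; have := H r; lia.
have neP' i ka : (forall r, part_nth la r = part_nth ka r + (r == i)) ->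
    ~ (forall r, part_nth nu r = part_nth ka r + (r == i)).
  move=> H1 H2; case/eqP: ne; apply: (part_eq pl pn) => r.
  by rewrite H1 H2.
(* Distinct shapes have at most one common shape above them and at most one below, so the two counts
   are truth values. *)
rewrite addn0 !count_uniq_has ?parts_uniq //; first last.
- move=> mu mu'; rewrite !mem_parts => pm pm' /andP[c1 c2] /andP[c3 c4].
  case/(coversP pl pm): c1 => i1 H1; case/(coversP pn pm): c2 => i2 H2.
  case/(coversP pl pm'): c3 => i3 H3; case/(coversP pn pm'): c4 => i4 H4.
  have n12 : i1 != i2.
    by apply/eqP => E; apply: (neP i1) => r; rewrite -H1 E -H2.
  have n34 : i3 != i4.
    by apply/eqP => E; apply: (neP i3) => r; rewrite -H3 E -H4.
  have E13 : i1 = i3.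
    by move: (H1 i1) (H2 i1) (H3 i1) (H4 i1); rewrite eqxx; do !case: eqP; lia.
  by apply: (part_eq pm pm') => r; move: (H1 r) (H3 r); rewrite E13; lia.
- move=> mu mu'; rewrite !mem_parts => pm pm' /andP[c1 c2] /andP[c3 c4].
  case/(coversP pm pl): c1 => i1 H1; case/(coversP pm pn): c2 => i2 H2.
  case/(coversP pm' pl): c3 => i3 H3; case/(coversP pm' pn): c4 => i4 H4.
  have n12 : i1 != i2 by apply/eqP => E; apply: (neP' _ _ H1); rewrite E.
  have n34 : i3 != i4 by apply/eqP => E; apply: (neP' _ _ H3); rewrite E.
  have E13 : i1 = i3.
    by move: (H1 i1) (H2 i1) (H3 i1) (H4 i1); rewrite eqxx; do !case: eqP; lia.
  by apply: (part_eq pm pm') => r; move: (H1 r) (H3 r); rewrite E13; lia.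
(* If [mu] is [la] with a box added in row [i1], and [nu] with one added in row [i2], then [la]
   without its last box in row [i2] lies below both; the other implication reverses this. *)
congr nat_of_bool; apply/hasP/hasP => -[mu]; rewrite mem_parts => pm /andP[c1 c2].
  case/(coversP pl pm): c1 => i1 H1; case/(coversP pn pm): c2 => i2 H2.
  have n12 : i1 != i2.
    by apply/eqP => E; apply: (neP i1) => r; rewrite -H1 E -H2.
  have hi : part_nth la i2.+1 < part_nth la i2.
    have := part_nth_anti pn (leqnSn i2); move: (H1 i2) (H2 i2) (H1 i2.+1) (H2 i2.+1).
    by rewrite !eqxx; do !case: eqP; lia.
  have [pd nd] := decr_nth_partition pl hi.
  exists (decr_nth la i2); first by rewrite mem_parts.
  apply/andP; split.
    apply/(coversP pd pl); exists i2 => r; rewrite nd.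
    by move: hi; case: (eqVneq r i2) => [->|]; lia.
  apply/(coversP pd pn); exists i1 => r; rewrite nd.
  by move: hi (H1 r) (H2 r); case: (eqVneq r i2) => [->|]; lia.
case/(coversP pm pl): c1 => i1 H1; case/(coversP pm pn): c2 => i2 H2.
have n12 : i1 != i2 by apply/eqP => E; apply: (neP' _ _ H1); rewrite E.
have ile : i2 <= size la.
  rewrite leqNgt; apply/negP => h; have := part_nth_anti pn (leq_pred i2).
  have := H1 i2.-1; have := H2 i2.-1; have := H2 i2; rewrite eqxx.
  rewrite (nth_default _ (_ : size la <= i2.-1)); last lia.
  by do !case: eqP; lia.
have pu : is_partition_of k.+2 (incr_nth la i2).
  rewrite incr_nth_partition //; case: i2 H2 n12 {ile} => //= i2 H2 n12.
  have := part_nth_anti pn (leqnSn i2); move: (H1 i2) (H2 i2) (H1 i2.+1) (H2 i2.+1).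
  by rewrite !eqxx; do !case: eqP; lia.
exists (incr_nth la i2); first by rewrite mem_parts.
apply/andP; split.
  by apply/(coversP pl pu); exists i2 => r; rewrite nth_incr_nth addnC eq_sym.
apply/(coversP pn pu); exists i1 => r; rewrite nth_incr_nth H1 H2.
by rewrite eq_sym; lia.
Qed.

(** Expanding each summand over the shapes below it gives walks from [la] up and down again.
    [count_ups_downs] trades them for walks down and then up, which the induction hypothesis sums,
    plus one extra copy of [la]. *)
Lemma sum_ups_num_syt k la : is_partition_of k la ->
  \sum_(mu <- parts k.+1 | covers la mu) num_syt k.+1 mu = k.+1 * num_syt k la.
Proof.
elim: k la => [|k IH] la pl.
  have -> : la = [::] by apply/eqP; move: pl; rewrite -mem_parts inE.
  have -> : parts 1 = [:: [:: 1]] by [].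
  by rewrite big_cons big_nil /= num_sytS (_ : parts 0 = [:: [::]]) // big_cons big_nil.
transitivity (\sum_(nu <- parts k.+1)
  count (fun mu => covers la mu && covers nu mu) (parts k.+2) * num_syt k.+1 nu).
  under eq_bigr do rewrite num_sytS.
  rewrite (exchange_big_dep predT) //=.
  apply: eq_bigr => nu _; rewrite big_const_seq iter_addn_0 mulnC.
  by congr (_ * _); apply: eq_count => mu /=; rewrite andbC.
transitivity (\sum_(nu <- parts k.+1)
  (\sum_(ka <- parts k | covers ka la && covers ka nu) num_syt k.+1 nu
    + (la == nu) * num_syt k.+1 nu)).
  rewrite [LHS]big_seq [RHS]big_seq; apply: eq_bigr => nu; rewrite mem_parts => pn.
  by rewrite count_ups_downs // mulnDl big_const_seq iter_addn_0 mulnC.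
rewrite big_split /= mulSn addnC; congr (_ + _).
  rewrite (bigD1_seq la) ?mem_parts ?parts_uniq //= eqxx mul1n.
  by rewrite big1 ?addn0 // => nu; rewrite eq_sym => /negPf ->.
rewrite (exchange_big_dep (covers^~ la)) /=; last by move=> ? ? _ /andP[].
rewrite num_sytS big_distrr /= [LHS]big_seq_cond [RHS]big_seq_cond.
apply: eq_bigr => ka /andP[]; rewrite mem_parts => pk ck.
by rewrite -(IH _ pk); apply: eq_bigl => nu; rewrite ck.
Qed.

(** One factor of each square is expanded over the shapes below; after exchanging the sums,
    [sum_ups_num_syt] supplies the factor [k.+1]. *)
Lemma sum_num_syt_sqr k : \sum_(la <- parts k) num_syt k la ^ 2 = k`!.
Proof.
elim: k => [|k IH]; first by rewrite (_ : parts 0 = [:: [::]]) // big_cons big_nil.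
transitivity (\sum_(mu <- parts k.+1) \sum_(la <- parts k | covers la mu)
    num_syt k.+1 mu * num_syt k la).
  by apply: eq_bigr => mu _; rewrite -big_distrr /= -num_sytS mulnn.
rewrite (exchange_big_dep predT) //= factS -IH big_distrr /=.
rewrite [LHS]big_seq [RHS]big_seq; apply: eq_bigr => la; rewrite mem_parts => pl.
by rewrite -big_distrl /= sum_ups_num_syt // -mulnA mulnn.
Qed.

(** * Tableaux *)

Definition cell_row (la : seq nat) (c : cell la) : nat := tag c.

(** The statistic usually written n(la). It is monotone against the dominance order but compares any
    two shapes, so one of the two directions of Schur's lemma always applies. *)
Definition row_weight (la : seq nat) : nat := \sum_(c : cell la) cell_row c.

Lemma cell_eqP la (c c' : cell la) :
  cell_row c = cell_row c' -> cell_col c = cell_col c' -> c = c'.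
Proof.
case: c c' => i j [i' j']; rewrite /cell_row /cell_col /= => /val_inj E.
by case: _ / E j' => j' /val_inj ->.
Qed.

Lemma cell_col_lt la (c : cell la) : cell_col c < part_nth la (cell_row c).
Proof. exact: ltn_ord. Qed.

Lemma cell_row_lt la (c : cell la) : cell_row c < size la.
Proof. exact: ltn_ord. Qed.

Lemma cell_exists la i j : j < part_nth la i ->
  exists c : cell la, cell_row c = i /\ cell_col c = j.
Proof.
move=> lt; have si : i < size la.
  by rewrite ltnNge; apply: contraL lt => h; rewrite nth_default.
pose i' := Ordinal si.
by exists (existT (fun i : 'I_(size la) => 'I_(part_nth la i)) i'
            (@Ordinal (part_nth la i') j lt)).
Qed.

Lemma card_cell_row la i : #|[set c : cell la | cell_row c == i]| = part_nth la i.
Proof.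
case: (ltnP i (size la)) => h; last first.
  rewrite nth_default //; apply/eqP; rewrite cards_eq0; apply/eqP/setP => c; rewrite !inE.
  by apply/negP => /eqP E; move: (cell_row_lt c); rewrite E ltnNge h.
pose i' := Ordinal h.
pose f (j : 'I_(part_nth la i')) : cell la :=
  Tagged (fun i : 'I_(size la) => 'I_(part_nth la i)) j.
rewrite -[RHS](card_ord (part_nth la i')) -(card_imset (f := f)) => [|j j' E].
  apply: eq_card => c; rewrite inE; apply/eqP/imsetP => [E|[j _ ->//]].
  have lt := cell_col_lt c; rewrite E in lt.
  by exists (@Ordinal (part_nth la i') _ lt) => //; apply: cell_eqP.
by apply: val_inj; apply: (congr1 (@cell_col la) E).
Qed.

Lemma card_cell la : #|cell la| = sumn la.
Proof.
rewrite card_tagged !sumnE big_map big_enum /= (big_nth 0%N) big_mkord.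
by apply: eq_bigr => i _; rewrite card_ord.
Qed.

Section Tableaux.

Variables (T : finType) (X : {set T}).
Implicit Types la mu : seq nat.

Lemma tableau_inj la (t : {ffun cell la -> T}) : is_tableau X t -> injective t.
Proof. by case/andP=> /injectiveP. Qed.

Lemma tableau_mem la (t : {ffun cell la -> T}) c : is_tableau X t -> t c \in X.
Proof. by case/andP=> _ /eqP <-; apply: imset_f. Qed.

Lemma tableau_onto la (t : {ffun cell la -> T}) x :
  is_tableau X t -> x \in X -> exists c, t c = x.
Proof. by case/andP=> _ /eqP <- /imsetP[c _ ->]; exists c. Qed.

Lemma tableau_exists la : #|X| = sumn la ->
  exists t : {ffun cell la -> T}, is_tableau X t.
Proof.
rewrite -card_cell => E.
pose t := [ffun c : cell la => enum_val (cast_ord (esym E) (enum_rank c))].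
have it : injective t.
  by move=> c c'; rewrite !ffunE => /enum_val_inj /cast_ord_inj /enum_rank_inj.
exists t; apply/andP; split; first exact/injectiveP.
rewrite eqEcard card_imset // E leqnn andbT.
by apply/subsetP=> _ /imsetP[c _ ->]; rewrite ffunE enum_valP.
Qed.

Lemma tableau_trans la (t t' : {ffun cell la -> T}) :
  is_tableau X t -> is_tableau X t' ->
  exists2 s, s \in Sym X & tableau_act t s = t'.
Proof.
move=> tX tX'; have it := tableau_inj tX; have it' := tableau_inj tX'.
pose f x := if [pick c | t c == x] is Some c then t' c else x.
have ft c : f (t c) = t' c.
  by rewrite /f; case: pickP => [c' /eqP/it ->//|/(_ c)]; rewrite eqxx.
have fN x : x \notin X -> f x = x.
  move=> nx; rewrite /f; case: pickP => // c /eqP E.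
  by rewrite -E (tableau_mem c tX) in nx.
have fX x : x \in X -> f x \in X.
  by case/(tableau_onto tX)=> c <-; rewrite ft tableau_mem.
have fi : injective f.
  move=> x y; case xX: (x \in X); case yX: (y \in X).
  - case/(tableau_onto tX): xX => c <-; case/(tableau_onto tX): yX => c' <-.
    by rewrite !ft => /it' ->.
  - by rewrite (fN y) ?yX // => E; rewrite -E fX in yX.
  - by rewrite (fN x) ?xX // => E; rewrite E fX in xX.
  - by rewrite !fN ?xX ?yX.
exists (perm fi); last by apply/ffunP=> c; rewrite ffunE permE ft.
by rewrite inE; apply/subsetP => x; rewrite inE permE; apply: contraR => /fN ->.
Qed.

Lemma col_stabP la (t : {ffun cell la -> T}) s :
  reflect (s \in Sym X /\
     forall c, exists2 c', cell_col c' = cell_col c & s (t c) = t c')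
    (s \in col_stab X t).
Proof.
rewrite [s \in col_stab X t]inE; apply: (iffP andP) => -[sX H]; split=> //.
  by move=> c; have /existsP[c' /andP[/eqP ? /eqP ?]] := forallP H c; exists c'.
apply/forallP=> c; have [c' E1 E2] := H c; apply/existsP; exists c'.
by rewrite E1 E2 !eqxx.
Qed.

Lemma col_stab_group_set la (t : {ffun cell la -> T}) : group_set (col_stab X t).
Proof.
apply/group_setP; split.
  by apply/col_stabP; rewrite group1; split=> // c; exists c; rewrite ?perm1.
move=> s s' /col_stabP[sX H] /col_stabP[sX' H']; apply/col_stabP.
split=> [|c]; first exact: groupM.
have [c1 E1 F1] := H c; have [c2 E2 F2] := H' c1.
by exists c2; rewrite ?E2 // permM F1 F2.
Qed.

Canonical col_stab_group la (t : {ffun cell la -> T}) :=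
  Group (col_stab_group_set t).

Lemma tperm_Sym x y : x \in X -> y \in X -> tperm x y \in Sym X.
Proof.
move=> xX yX; rewrite inE; apply/subsetP=> z; rewrite inE; apply: contraR => nz.
by rewrite tpermD //; apply: contraNneq nz => <-.
Qed.

Lemma tperm_col_stab la (t : {ffun cell la -> T}) c c' : is_tableau X t ->
  cell_col c = cell_col c' -> tperm (t c) (t c') \in col_stab X t.
Proof.
move=> tX E; apply/col_stabP; split=> [|d].
  by rewrite tperm_Sym ?tableau_mem.
case: tpermP => [/(tableau_inj tX) ->|/(tableau_inj tX) ->|_ _].
- by exists c'.
- by exists c.
- by exists d.
Qed.

(* Within a column, [j c] counts the cells whose image lies higher; it is at
   most the row of the image, while the [j c] fill the column from the top. *)
Lemma transversal_rows k la mu (f : cell la -> cell mu) :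
    is_partition_of k la -> injective f -> row_weight mu <= row_weight la ->
    sumn mu = k ->
    (forall c c', cell_col c = cell_col c' ->
       cell_row (f c) = cell_row (f c') -> c = c') ->
  exists2 p : {perm cell la}, (forall c, cell_col (p c) = cell_col c) &
    forall c, cell_row (p c) = cell_row (f c).
Proof.
move=> pl fi wle sm H; pose r c := cell_row (f c).
pose A c := [set c' | (cell_col c' == cell_col c) && (r c' < r c)].
pose j c := #|A c|.
have bnd (B : {set cell la}) (h : cell la -> nat) m :
    {in B &, injective h} -> (forall c, c \in B -> h c < m) -> #|B| <= m.
  move=> hi hm; rewrite cardE -(size_map h) -(size_iota 0 m); apply: uniq_leq_size.
    by rewrite map_inj_in_uniq ?enum_uniq // => c c'; rewrite !mem_enum; apply: hi.
  by move=> _ /mapP[c cB ->]; rewrite mem_enum in cB; rewrite mem_iota hm.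
have jr c : j c <= r c.
  apply: (bnd _ r) => [c1 c2|c1]; rewrite !inE.
    by move=> /andP[/eqP E1 _] /andP[/eqP E2 _] E; apply: H; rewrite ?E1 ?E2.
  by case/andP.
(* Otherwise the column of [c] has at most [j c] cells, although [A c] is a proper part of it. *)
have jcol c : cell_col c < part_nth la (j c).
  rewrite ltnNge; apply/negP => h.
  have : #|[set c' : cell la | cell_col c' == cell_col c]| <= j c.
    apply: (bnd _ (@cell_row la)) => [c1 c2|c1]; rewrite !inE.
      by move=> /eqP E1 /eqP E2 E; apply: cell_eqP; rewrite ?E1 ?E2.
    move=> /eqP E1; rewrite ltnNge; apply/negP => /(part_nth_anti pl) h1.
    by have := cell_col_lt c1; rewrite ltnNge E1 (leq_trans h1 h).
  rewrite leqNgt => /negP[]; apply: proper_card; apply/properP; split.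
    by apply/subsetP=> c'; rewrite !inE => /andP[].
  by exists c; rewrite !inE ?eqxx ?ltnn.
have [p pP] : exists p : cell la -> cell la,
    forall c, cell_row (p c) = j c /\ cell_col (p c) = cell_col c.
  by apply: (fin_all_exists
    (P := fun c d => cell_row d = j c /\ cell_col d = cell_col c)) => c;
    apply/cell_exists/jcol.
have jlt c c' : cell_col c = cell_col c' -> r c < r c' -> j c < j c'.
  move=> E lt; apply: proper_card; apply/properP; split.
    apply/subsetP=> d; rewrite !inE E => /andP[-> h] /=.
    exact: ltn_trans h lt.
  by exists c; rewrite !inE ?E ?eqxx ?ltnn ?lt.
have pi : injective p.
  move=> c c' E; have [Ej Ec] := pP c; have [Ej' Ec'] := pP c'.
  have cE : cell_col c = cell_col c' by rewrite -Ec E Ec'.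
  apply: H => //; have jE : j c = j c' by rewrite -Ej E Ej'.
  case: (ltngtP (r c) (r c')) => // [/(jlt _ _ cE)|/(jlt _ _ (esym cE))].
    by rewrite jE ltnn.
  by rewrite jE ltnn.
exists (perm pi) => c; rewrite permE; first by case: (pP c).
(* [j] is at most [r] at each cell, with sums [row_weight la] and [row_weight mu]; the assumed
   inequality between the sums forces equality everywhere. *)
case: (pP c) => -> _; apply/eqP; rewrite eqn_leq jr /=.
have fsum : \sum_c r c = row_weight mu.
  have fb : bijective f.
    apply: inj_card_bij => //; rewrite !card_cell sm.
    by case/and3P: pl => _ _ /eqP ->.
  rewrite /row_weight (reindex f) //; exact: onW_bij.
have jsum : \sum_c j c = row_weight la.
  rewrite [RHS](reindex_inj pi) /=; apply: eq_bigr => d _.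
  by case: (pP d).
have : \sum_c (r c - j c) = 0.
  by apply/eqP; rewrite sumnB // fsum jsum subn_eq0.
by move/eqP; rewrite sum_nat_eq0 => /forallP/(_ c); rewrite implyTb subn_eq0.
Qed.

Lemma transversal_shape k la mu (f : cell la -> cell mu) (p : {perm cell la}) :
    is_partition_of k la -> is_partition_of k mu -> injective f ->
  (forall c, cell_row (p c) = cell_row (f c)) -> la = mu.
Proof.
move=> pl pm fi E; apply: (part_eq pl pm) => i.
have fb : bijective f.
  apply: inj_card_bij => //; rewrite !card_cell.
  by case/and3P: pl => _ _ /eqP ->; case/and3P: pm => _ _ /eqP ->.
rewrite -!card_cell_row -(card_preimset _ (@perm_inj _ p)) -(on_card_preimset (f := f)).
  by apply: eq_card => c; rewrite !inE E.
exact: onW_bij.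
Qed.

End Tableaux.

Import Order.TTheory GRing.Theory Num.Theory.
Local Open Scope ring_scope.

(** * Intertwiners *)

(** In a full-rank factorisation [E = B *m C] of an idempotent, [C *m B] is the identity of size the
    rank. *)
Lemma mxtrace_idem (F : fieldType) n (E : 'M[F]_n) :
  E *m E = E -> \tr E = (\rank E)%:R.
Proof.
move=> EE; rewrite -[in LHS](mulmx_base E) mxtrace_mulC.
move: (col_base_full E) (row_base_free E) (mulmx_base E).
move: (col_base E) (row_base E) => B C fullB freeC BC.
suff -> : C *m B = 1%:M by rewrite mxtrace1.
apply: (row_free_inj freeC); apply: (row_full_inj fullB).
by rewrite mul1mx !mulmxA BC -mulmxA BC.
Qed.

Lemma mxtrace_lin_mx (F : fieldType) m n (f : 'M[F]_(m, n) -> 'M[F]_(m, n)) :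
  \tr (lin_mx f) = \sum_i \sum_j f (delta_mx i j) i j.
Proof.
rewrite /mxtrace pair_bigA (reindex _ (curry_mxvec_bij m n)) /=.
by apply: eq_bigr => -[i j] _; rewrite mxE /= vec_mx_delta mxvecE.
Qed.

Section Intertwiners.

Variables (F : numFieldType) (gT : finGroupType) (G : {group gT}).
Variables (d1 d2 : nat).
Variables (r1 : mx_representation F G d1) (r2 : mx_representation F G d2).

Definition intertwines (A : 'M[F]_(d1, d2)) : Prop :=
  forall g, g \in G -> r1 g *m A = A *m r2 g.

Definition average (A : 'M[F]_(d1, d2)) : 'M[F]_(d1, d2) :=
  #|G|%:R^-1 *: \sum_(g in G) r1 g^-1%g *m A *m r2 g.

Lemma card_neq0 : #|G|%:R != 0 :> F.
Proof. by rewrite pnatr_eq0 -lt0n cardG_gt0. Qed.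

Lemma average_is_linear : linear average.
Proof.
move=> a A B; rewrite /average scalerA mulrC -scalerA -scalerDr; congr (_ *: _).
rewrite scaler_sumr -big_split /=; apply: eq_bigr => g _.
by rewrite mulmxDr mulmxDl -scalemxAr -scalemxAl.
Qed.

HB.instance Definition _ :=
  GRing.isLinear.Build F _ _ _ average average_is_linear.

Lemma average_intertwines A : intertwines (average A).
Proof.
move=> h hG; rewrite /average -scalemxAr -scalemxAl; congr (_ *: _).
rewrite mulmx_sumr mulmx_suml (reindex_inj (mulIg h)) /=.
apply: eq_big => [g|g]; first by rewrite groupMr.
rewrite groupMr // => gG; rewrite (repr_mxM r2) // !mulmxA; congr (_ *m _ *m _ *m _).
by rewrite -repr_mxM ?groupV ?groupM // invMg mulKVg.
Qed.

Lemma average_id A : intertwines A -> average A = A.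
Proof.
move=> hA; rewrite /average (eq_bigr (fun=> A)) => [|g gG].
  by rewrite sumr_const -scaler_nat scalerA mulVf ?card_neq0 ?scale1r.
by rewrite hA ?groupV // -mulmxA -repr_mxM ?groupV // mulVg repr_mx1 mulmx1.
Qed.

(** Orthogonality before Schur's lemma: the product of the diagonal entries [i] of [r1 g^-1] and [j]
    of [r2 g *m B] is the entry [(i, j)] of the contribution of [g] to the average of
    [delta_mx i j], multiplied by [B]. *)
Lemma sum_mxtrace_average B :
  \sum_(g in G) \tr (r1 g^-1%g) * \tr (r2 g *m B) =
  #|G|%:R * \sum_i \sum_j (average (delta_mx i j) *m B) i j.
Proof.
pose f i j := \sum_(g in G) r1 g^-1%g i i * (r2 g *m B) j j.
transitivity (\sum_i \sum_j f i j).
  symmetry; rewrite /f; under eq_bigr do rewrite exchange_big /=.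
  rewrite exchange_big /=; apply: eq_bigr => g _.
  by rewrite mulr_suml; apply: eq_bigr => i _; rewrite mulr_sumr.
rewrite mulr_sumr; apply: eq_bigr => i _; rewrite mulr_sumr; apply: eq_bigr => j _.
rewrite -scalemxAl mxE mulrA mulfV ?card_neq0 // mul1r mulmx_suml summxE.
apply: eq_bigr => g _; rewrite -(mul_delta_mx (0 : 'I_1)) !mulmxA -colE.
by rewrite -!mulmxA -rowE [in RHS]mxE big_ord1 [col _ _ _ _]mxE [row _ _ _ _]mxE.
Qed.

Lemma sum_mxtrace_no_intertwiner B : (forall A, intertwines A -> A = 0) ->
  \sum_(g in G) \tr (r1 g^-1%g) * \tr (r2 g *m B) = 0.
Proof.
move=> A0; rewrite sum_mxtrace_average big1 ?mulr0 // => i _.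
by rewrite big1 // => j _; rewrite (A0 _ (average_intertwines _)) mul0mx mxE.
Qed.

Definition hom_dim : nat := \rank (lin_mx average).

(* [average] projects onto the intertwiners, so its trace is their dimension. *)
Lemma sum_mxtrace_hom_dim :
  \sum_(g in G) \tr (r1 g^-1%g) * \tr (r2 g) = #|G|%:R * hom_dim%:R.
Proof.
have PP : lin_mx average *m lin_mx average = lin_mx average.
  apply/row_matrixP=> i; rewrite !rowE mulmxA.
  rewrite -[delta_mx 0 i](vec_mxK (m := d1)) !mul_vec_lin /=; congr mxvec.
  by rewrite average_id //; apply: average_intertwines.
have := sum_mxtrace_average 1%:M; rewrite /hom_dim -mxtrace_idem // mxtrace_lin_mx.
by under eq_bigr do rewrite mulmx1; under [in RHS]eq_bigr do
   under eq_bigr do rewrite mulmx1.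
Qed.

Lemma hom_dim_gt0 A : intertwines A -> A != 0 -> (0 < hom_dim)%N.
Proof.
move=> hA; apply: contraNltn; rewrite leqn0 mxrank_eq0 => /eqP P0; apply/eqP.
by apply: (can_inj mxvecK); rewrite linear0 -(average_id hA) -mul_vec_lin P0 mulmx0.
Qed.

End Intertwiners.

(** Schur's lemma is a hypothesis here because for Specht modules it is proved from polytabloids.
    The scalar that averages [delta_mx i j] is found from its trace. *)
Lemma sum_mxtrace_scalar (F : numFieldType) (gT : finGroupType) (G : {group gT})
    (d : nat) (r : mx_representation F G d) (B : 'M[F]_d) :
    (forall A, intertwines r r A -> is_scalar_mx A) -> (0 < d)%N ->
  \sum_(g in G) \tr (r g^-1%g) * \tr (r g *m B) = #|G|%:R / d%:R * \tr B.
Proof.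
move=> sc d0; rewrite sum_mxtrace_average -mulrA; congr (_ * _).
have dn0 : d%:R != 0 :> F by rewrite pnatr_eq0 -lt0n.
have avE i j : average r r (delta_mx i j) = ((i == j)%:R / d%:R)%:M.
  have /is_scalar_mxP[c cE] := sc _ (average_intertwines r r (delta_mx i j)).
  rewrite cE; congr (_%:M); have := congr1 mxtrace cE.
  rewrite mxtrace_scalar linearZ /= linear_sum /= (eq_bigr (fun=> (i == j)%:R)).
    rewrite sumr_const -[_ *+ #|_|]mulr_natl mulKf ?card_neq0 // => ->.
    by rewrite -(mulr_natr c) mulfK.
  move=> g gG; rewrite mxtrace_mulC mulmxA -repr_mxM ?groupV // mulgV repr_mx1.
  rewrite mul1mx -(mul_delta_mx (0 : 'I_1)) mxtrace_mulC mul_delta_mx_cond.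
  by rewrite raddfMn /= trace_mx11 mxE !eqxx eq_sym.
transitivity (\sum_i \sum_j (i == j)%:R / d%:R * B i j).
  by apply: eq_bigr => i _; apply: eq_bigr => j _; rewrite avE mul_scalar_mx mxE.
rewrite mulr_sumr; apply: eq_bigr => i _.
rewrite (bigD1 i) //= eqxx mul1r big1 ?addr0 // => j /negPf ji.
by rewrite eq_sym ji !mul0r.
Qed.

(** * Specht modules *)

Section Polytabloids.

Variables (F : numFieldType) (T : finType) (X : {set T}).
Implicit Types la mu : seq nat.

Local Notation vec := (tabloid_vec F).
Local Notation tmx := (tabloid_mx F).
Local Notation poly := (polytabloid F X).

Lemma tabloid_mx1 mu : tmx mu (1 : {perm T})%g = 1%:M.
Proof. by have [] := tabloid_mx_repr F mu [set: {perm T}]%G. Qed.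

Lemma tabloid_mxM mu (s s' : {perm T}) : tmx mu (s * s')%g = tmx mu s *m tmx mu s'.
Proof. by have [_ ->] := tabloid_mx_repr F mu [set: {perm T}]%G; rewrite ?inE. Qed.

(** The tabloids acted on may have a shape [mu] other than that of [t]; this is what compares two
    Specht modules. *)
Definition col_sym la (t : {ffun cell la -> T}) mu : 'M[F]_#|tabloid T mu| :=
  \sum_(s in col_stab X t) (-1) ^+ odd_perm s *: tmx mu s.

Lemma polytabloidE la (t : {ffun cell la -> T}) :
  poly t = vec (tabloid_of t) *m col_sym t la.
Proof.
rewrite /polytabloid mulmx_sumr; apply: eq_bigr => s _.
by rewrite -scalemxAr tabloid_vec_act tabloid_of_act.
Qed.

Lemma col_sym_mull la (t : {ffun cell la -> T}) mu q : q \in col_stab X t ->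
  tmx mu q *m col_sym t mu = (-1) ^+ odd_perm q *: col_sym t mu.
Proof.
move=> qC; rewrite mulmx_sumr [in RHS]/col_sym scaler_sumr [RHS](reindex_inj (mulgI q)) /=.
apply: eq_big => [s|s sC]; first by rewrite groupMl.
rewrite -scalemxAr tabloid_mxM scalerA -signr_addb odd_permM; congr (_ *: _).
by rewrite addbA addbb.
Qed.

Lemma polytabloid_col_sym la (t : {ffun cell la -> T}) :
  poly t *m col_sym t la = #|col_stab X t|%:R *: poly t.
Proof.
rewrite polytabloidE -mulmxA {1}/col_sym mulmx_suml mulmx_sumr.
rewrite (eq_bigr (fun=> vec (tabloid_of t) *m col_sym t la)) => [|q qC].
  by rewrite sumr_const scaler_nat.
rewrite -scalemxAl col_sym_mull // scalerA -signr_addb addbb.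
by rewrite scale1r.
Qed.

(* If two entries of a column of [t] share a row of [t'], their transposition
   fixes the tabloid of [t'] but changes the sign of the column sum. *)
Lemma tabloid_col_sym k la mu (t : {ffun cell la -> T}) (t' : {ffun cell mu -> T}) :
    is_partition_of k la -> is_partition_of k mu ->
    is_tableau X t -> is_tableau X t' -> (row_weight mu <= row_weight la)%N ->
  vec (tabloid_of t') *m col_sym t mu = 0 \/
  (la = mu /\ exists2 q, q \in col_stab X t &
     forall c, q (t c) \in [set t' c' | c' : cell mu & cell_row c' == cell_row c]).
Proof.
move=> pl pm tX tX' wle; have it := tableau_inj tX; have it' := tableau_inj tX'.
have [f fE] : exists f : cell la -> cell mu, forall c, t' (f c) = t c.
  apply: (fin_all_exists (P := fun c d => t' d = t c)) => c.
  exact: tableau_onto tX' (tableau_mem c tX).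
have fi : injective f by move=> c c' E; apply: it; rewrite -!fE E.
case: (boolP [exists c, [exists c', [&& c != c', cell_col c == cell_col c' &
                cell_row (f c) == cell_row (f c')]]]).
  case/existsP=> c /existsP[c' /and3P[cc' /eqP Ec /eqP Er]]; left.
  set q := tperm (t c) (t c').
  have qC : q \in col_stab X t by apply: tperm_col_stab.
  have qE : tabloid_act (tabloid_of t') q = tabloid_of t'.
    rewrite -tabloid_of_act; apply/ffunP=> i; rewrite !ffunE.
    have key d : exists2 d', cell_row d' = cell_row d & q (t' d) = t' d'.
      rewrite /q -!fE; case: tpermP => [/it' ->|/it' ->|_ _].
      - by exists (f c').
      - by exists (f c).
      - by exists d.
    have qK : cancel q q by apply: tpermK.
    apply/setP=> x; apply/imsetP/imsetP=> -[d]; rewrite inE => /eqP di ->.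
      have [d' E1 E2] := key d; exists d'; rewrite ?inE ?ffunE //.
      by apply/eqP/val_inj; rewrite -di; apply: E1.
    have [d' E1 E2] := key d; exists d'; rewrite ?inE ?ffunE.
      by apply/eqP/val_inj; rewrite -di; apply: E1.
    by rewrite -E2 qK.
  have := col_sym_mull mu qC; move/(congr1 (mulmx (vec (tabloid_of t')))).
  rewrite mulmxA tabloid_vec_act qE -scalemxAr odd_tperm (inj_eq it) cc' expr1.
  rewrite scaleN1r => /eqP; rewrite -subr_eq0 opprK -mulr2n -scaler_nat.
  by rewrite scaler_eq0 pnatr_eq0 => /eqP.
rewrite negb_exists => /forallP H; right.
have H' c c' : cell_col c = cell_col c' -> cell_row (f c) = cell_row (f c') -> c = c'.
  move=> E1 E2; apply/eqP; apply: contraT => cc'.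
  by have := H c; rewrite negb_exists => /forallP/(_ c'); rewrite cc' E1 E2 !eqxx.
have sm : sumn mu = k by case/and3P: pm => _ _ /eqP.
have [p pc pr] := transversal_rows pl fi wle sm H'.
split; first exact: (transversal_shape pl pm fi pr).
(* The rearrangement [p] of cells within columns is turned into a permutation [q] of entries, which
   then lies in the column stabiliser of [t]. *)
pose t2 := [ffun c => t ((p^-1)%g c)].
have t2X : is_tableau X t2.
  apply/andP; split.
    by apply/injectiveP=> c c'; rewrite !ffunE => /it /perm_inj.
  case/andP: tX => _ /eqP <-; apply/eqP/setP=> x.
  apply/imsetP/imsetP=> -[c _ ->]; first by rewrite ffunE; exists ((p^-1)%g c).
  by exists (p c); rewrite ?ffunE ?permK.
have [q qX qE] := tableau_trans tX t2X.
have qt c : q (t c) = t ((p^-1)%g c).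
  by have := congr1 (fun u : {ffun _} => u c) qE; rewrite !ffunE.
exists q.
  apply/col_stabP; split=> // c; exists ((p^-1)%g c) => //.
  by rewrite -pc permKV.
move=> c; rewrite qt -fE; apply: imset_f; rewrite inE -pr permKV.
by [].
Qed.

(** The coefficient at the tabloid of [t] itself is 1, since a column permutation that preserves
    every row is trivial. *)
Lemma polytabloid_neq0 la (t : {ffun cell la -> T}) : is_tableau X t -> poly t != 0.
Proof.
move=> tX; have it := tableau_inj tX; apply/eqP => /rowP/(_ (enum_rank (tabloid_of t))).
rewrite mxE summxE (bigD1 1%g) ?group1 //= odd_perm1 expr0 scale1r big1 ?addr0.
  have -> : tableau_act t 1 = t by apply/ffunP=> c; rewrite ffunE perm1.
  by rewrite mxE !eqxx => /eqP; rewrite oner_eq0.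
move=> s /andP[sC s1]; rewrite 2!mxE eqxx /= (inj_eq enum_rank_inj).
case: eqP => [E|_]; last by rewrite mulr0.
case/eqP: s1; apply/permP=> x; rewrite perm1.
case/col_stabP: sC => sX H; case xX: (x \in X); last first.
  by move: sX; rewrite inE => /out_perm -> //; rewrite xX.
case/(tableau_onto tX): xX => c <-; have [c' cc' sc] := H c.
have : s (t c) \in tabloid_of t (tag c).
  by rewrite E ffunE; apply/imsetP; exists c; rewrite ?inE ?ffunE.
rewrite ffunE => /imsetP[d]; rewrite inE sc => /eqP dc /it c'd.
have -> // : c = c'.
by apply: cell_eqP; rewrite ?cc' // c'd /cell_row dc.
Qed.

End Polytabloids.

Section SpechtHom.

Variables (F : numFieldType) (T : finType) (X : {set T}).
Implicit Types la mu : seq nat.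

Local Notation vec := (tabloid_vec F).
Local Notation tmx := (tabloid_mx F).
Local Notation poly := (polytabloid F X).
Local Notation S la := (specht_mx F la X).
Local Notation rep la := (specht_repr F la X).

Lemma polytabloid_sub la (t : {ffun cell la -> T}) :
  is_tableau X t -> (poly t <= S la)%MS.
Proof. by move=> tX; rewrite (sumsmx_sup t) ?genmxE. Qed.

Lemma specht_sub la m (A : 'M[F]_(m, _)) :
  (forall t, is_tableau X t -> (poly t <= A)%MS) -> (S la <= A)%MS.
Proof. by move=> H; apply/sumsmx_subP=> t tX; rewrite genmxE H. Qed.

Lemma specht_rank_gt0 la : #|X| = sumn la -> (0 < \rank (S la))%N.
Proof.
case/tableau_exists=> t tX; rewrite lt0n mxrank_eq0.
apply: contraNneq (polytabloid_neq0 F tX) => S0.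
by have := polytabloid_sub tX; rewrite S0 submx0.
Qed.

Lemma tabloid_rows_eq la (t1 t2 : {ffun cell la -> T}) :
    is_tableau X t1 -> is_tableau X t2 ->
  (forall c, t1 c \in [set t2 c' | c' : cell la & cell_row c' == cell_row c]) ->
  tabloid_of t1 = tabloid_of t2.
Proof.
move=> t1X t2X H; apply/ffunP=> i; rewrite !ffunE; apply/eqP.
rewrite eqEcard (card_imset _ (tableau_inj t1X))
  (card_imset _ (tableau_inj t2X)) leqnn andbT.
apply/subsetP=> _ /imsetP[c ci ->]; move: ci; rewrite inE => /eqP <-.
by have /imsetP[c' cc' ->] := H c; apply/imsetP; exists c'.
Qed.

Lemma tabloid_col_sym_eq k la (t t' : {ffun cell la -> T}) :
    is_partition_of k la -> is_tableau X t -> is_tableau X t' ->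
  (vec (tabloid_of t') *m col_sym F X t la <= poly t)%MS.
Proof.
move=> pl tX tX'; have [->|[_ [q qC qE]]] := tabloid_col_sym F pl pl tX tX' (leqnn _).
  exact: sub0mx.
have <- : tabloid_of (tableau_act t q) = tabloid_of t'.
  apply: tabloid_rows_eq => //; first by apply: is_tableau_act; case/col_stabP: qC.
  by move=> c; rewrite ffunE.
rewrite tabloid_of_act -tabloid_vec_act -mulmxA col_sym_mull // -scalemxAr.
by rewrite -polytabloidE scalemx_sub.
Qed.

Lemma specht_col_sym la mu (t : {ffun cell la -> T}) m (A : 'M[F]_(m, _)) :
    (forall t' : {ffun cell mu -> T}, is_tableau X t' ->
       (vec (tabloid_of t') *m col_sym F X t mu <= A)%MS) ->
  (S mu *m col_sym F X t mu <= A)%MS.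
Proof.
move=> H; rewrite sumsmxMr; apply/sumsmx_subP=> t' tX'.
rewrite (eqmxMr _ (genmxE _)) /polytabloid mulmx_suml; apply: summx_sub => s.
case/col_stabP=> sX _; rewrite -scalemxAl scalemx_sub // H //.
exact: is_tableau_act.
Qed.

(** The signed column sum is a combination of group elements, so intertwiners commute with it. The
    image of [poly t] is thus again an eigenvector with nonzero eigenvalue, and so lies in the range
    of the column sum. *)
Lemma val_specht_hom la mu (A : 'M[F]_(\rank (S la), \rank (S mu)))
    (t : {ffun cell la -> T}) :
    intertwines (rep la) (rep mu) A -> is_tableau X t ->
  let v := val_submod (in_submod (S la) (poly t) *m A) in
  v *m col_sym F X t mu = #|col_stab X t|%:R *: v.
Proof.
move=> hA tX v; rewrite /v.
transitivity (val_submod (in_submod (S la) (poly t *m col_sym F X t la) *m A));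
  last first.
  by rewrite polytabloid_col_sym linearZ /= -scalemxAl linearZ.
move: (poly t) (polytabloid_sub tX) => e eS {v}.
rewrite /col_sym !mulmx_sumr linear_sum mulmx_suml linear_sum /=.
apply: eq_bigr => s /col_stabP[sX _].
rewrite -!scalemxAr linearZ /= -scalemxAl linearZ /=; congr (_ *: _).
rewrite (in_submodJ (specht_module F la X)) //.
rewrite -[LHS](val_submodJ (specht_module F mu X) (in_submod (S la) e *m A) sX).
by rewrite -[in LHS]mulmxA -(hA s) // [in LHS]mulmxA.
Qed.

Lemma specht_hom_eq0 la m (A : 'M[F]_(\rank (S la), m)) :
    (forall t, is_tableau X t -> in_submod (S la) (poly t) *m A = 0) -> A = 0.
Proof.
move=> H; have : (S la <= kermx (in_submod (S la) 1%:M *m A))%MS.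
  by apply: specht_sub => t tX; apply/sub_kermxP; rewrite mulmxA -in_submodE H.
move/(submx_trans (val_submodP (1%:M : 'M_(\rank (S la))))) => /sub_kermxP.
by rewrite mulmxA -in_submodE val_submodK mul1mx.
Qed.

(** In this direction the column sums of tableaux of shape [la] kill all of [S mu]. Orthogonality of
    characters handles the other order of weights by exchanging the two shapes. *)
Lemma specht_hom_neq k la mu (A : 'M[F]_(\rank (S la), \rank (S mu))) :
    is_partition_of k la -> is_partition_of k mu -> la != mu ->
    (row_weight mu <= row_weight la)%N ->
  intertwines (rep la) (rep mu) A -> A = 0.
Proof.
move=> pl pm ne wle hA; apply: specht_hom_eq0 => t tX.
have := val_specht_hom hA tX => /=; set v := val_submod _ => vE.
have : (S mu *m col_sym F X t mu <= (0 : 'M[F]_#|tabloid T mu|))%MS.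
  apply: specht_col_sym => t' tX'.
  have [->|[E _]] := tabloid_col_sym F pl pm tX tX' wle; first exact: sub0mx.
  by rewrite E eqxx in ne.
have vS : (v <= S _)%MS by apply: val_submodP.
move/(submx_trans (submxMr _ vS)); rewrite vE.
rewrite submx0 scaler_eq0 pnatr_eq0 -leqn0 leqNgt cardG_gt0 /=.
by rewrite val_submod_eq0 => /eqP.
Qed.

(** The column sum of [t] maps the module into the line of [poly t], so [A] multiplies this vector
    by a scalar; its translates span the module. Without any tableau the module is zero. *)
Lemma specht_hom_scalar k la (A : 'M[F]_(\rank (S la))) :
    is_partition_of k la ->
  intertwines (rep la) (rep la) A -> is_scalar_mx A.
Proof.
move=> pl hA; case: (pickP (is_tableau X (la := la))) => [t tX|no]; last first.
  suff -> : A = 0 by apply/is_scalar_mxP; exists 0; rewrite raddf0.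
  by apply: specht_hom_eq0 => t; rewrite no.
have := val_specht_hom hA tX => /=; set v := val_submod _ => vE.
have : (S la *m col_sym F X t la <= poly t)%MS.
  by apply: specht_col_sym => t' tX'; apply: tabloid_col_sym_eq pl tX tX'.
have vS : (v <= S _)%MS by apply: val_submodP.
move/(submx_trans (submxMr _ vS)); rewrite vE => /sub_rVP[a aE].
have vE' : v = (a / #|col_stab X t|%:R) *: poly t.
  rewrite mulrC -scalerA -aE scalerA mulVf ?scale1r //.
  by rewrite pnatr_eq0 -lt0n cardG_gt0.
move: (a / _) vE' => c vE'; apply/is_scalar_mxP; exists c; apply/eqP.
rewrite -subr_eq0; apply/eqP; apply: specht_hom_eq0 => t' tX'.
have [s sX <-] := tableau_trans tX tX'; rewrite -polytabloid_act //.
rewrite (in_submodJ (specht_module F la X)) ?polytabloid_sub //.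
have hB : intertwines (rep la) (rep la) (A - c%:M).
  by move=> g gX; rewrite mulmxBr mulmxBl hA // scalar_mxC.
rewrite -mulmxA (hB s) // mulmxA mulmxBr mul_mx_scalar -linearZ /= -vE'.
by rewrite /v val_submodK subrr mul0mx.
Qed.

End SpechtHom.

(** Frees the trace from the basis built into [submod_repr], so that bases obtained by complex
    conjugation or by translation can be used. *)
Lemma mxtrace_submod_basis (F : fieldType) (gT : finGroupType) (G : {group gT})
    n (rG : mx_representation F G n) (U : 'M[F]_n) (modU : mxmodule rG U)
    r (B : 'M[F]_(r, n)) (A : 'M[F]_r) x :
    row_free B -> (B :=: U)%MS -> x \in G -> B *m rG x = A *m B ->
  \tr (submod_repr modU x) = \tr A.
Proof.
move=> fB BU xG BA; have [Q QB] : exists Q, val_submod (1%:M : 'M_(\rank U)) = Q *m B.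
  by apply/submxP; rewrite BU val_submod1.
set P := in_submod U B; have PB : val_submod P = B by rewrite in_submodK ?BU.
have QP : Q *m P = 1%:M.
  apply: val_submod_inj; rewrite val_submodE -mulmxA -val_submodE PB.
  by rewrite -QB.
have PQ : P *m Q = 1%:M.
  by apply: (row_free_inj fB); rewrite mul1mx -mulmxA -QB -val_submodE PB.
have sub : P *m submod_repr modU x = A *m P.
  transitivity (in_submod U (A *m B)); last by rewrite in_submodE -mulmxA -in_submodE.
  by rewrite -BA (in_submodJ modU) ?BU.
rewrite -[submod_repr _ _]mul1mx -QP -mulmxA sub mulmxA mxtrace_mulC mulmxA PQ.
by rewrite mul1mx.
Qed.

(** * Specht characters: reality, inversion and conjugation *)

Section SpechtChar.

Variables (C : numClosedFieldType) (T : finType).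
Implicit Types (X : {set T}) (la mu : seq nat).

Local Notation tmx := (tabloid_mx C).
Local Notation poly X := (polytabloid C X).
Local Notation S la X := (specht_mx C la X).
Local Notation chi la X := (specht_char C la X).

Lemma specht_char_basis la X r (B : 'M[C]_(r, _)) (A : 'M[C]_r) s :
    row_free B -> (B :=: S la X)%MS -> s \in Sym X -> B *m tmx la s = A *m B ->
  chi la X s = \tr A.
Proof.
move=> fB BS sX BA.
exact: (mxtrace_submod_basis (specht_module C la X) fB BS sX BA).
Qed.

Lemma specht_base la X s : s \in Sym X ->
  row_base (S la X) *m tmx la s = specht_repr C la X s *m row_base (S la X).
Proof.
move=> sX; have := val_submodJ (specht_module C la X) 1%:M sX.
by rewrite mul1mx /val_submod /= mul1mx.
Qed.

Lemma tabloid_mxE la s i j :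
  tmx la s i j = (enum_val j == tabloid_act (enum_val i) s :> tabloid T la)%:R.
Proof.
by rewrite mxE mxE eqxx /= -(inj_eq enum_rank_inj) enum_valK.
Qed.

Lemma tabloid_actK la (s : {perm T}) (D : tabloid T la) :
  tabloid_act (tabloid_act D s) s^-1%g = D.
Proof.
apply/ffunP=> i; rewrite !ffunE -imset_comp.
by rewrite (eq_imset _ (permK s)) imset_id.
Qed.

Lemma tabloid_mx_tr la (s : {perm T}) : (tmx la s)^T = tmx la s^-1%g.
Proof.
apply/matrixP=> i j; rewrite mxE !tabloid_mxE; congr (nat_of_bool _)%:R.
apply/eqP/eqP=> ->; first by rewrite tabloid_actK.
by rewrite -{2}[s]invgK tabloid_actK.
Qed.

Lemma map_tabloid_mx la (f : {rmorphism C -> C}) (s : {perm T}) :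
  map_mx f (tmx la s) = tmx la s.
Proof. by apply/matrixP=> i j; rewrite mxE tabloid_mxE rmorph_nat. Qed.

Lemma map_polytabloid la X (f : {rmorphism C -> C}) (t : {ffun cell la -> T}) :
  map_mx f (poly X t) = poly X t.
Proof.
rewrite /polytabloid map_mx_sum; apply: eq_bigr => s _.
by rewrite map_mxZ map_delta_mx rmorph_sign.
Qed.

(** Polytabloids have integer coordinates, so the module is stable under complex conjugation. *)
Lemma specht_char_conj la X s : s \in Sym X -> (chi la X s)^* = chi la X s.
Proof.
move=> sX; pose f := @Num.conj C : {rmorphism C -> C}.
have Sf : (S la X <= map_mx f (S la X))%MS.
  by apply: specht_sub => t tX; rewrite -(map_polytabloid X f) map_submx polytabloid_sub.
have ff m n (M : 'M[C]_(m, n)) : map_mx f (map_mx f M) = M.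
  by apply/matrixP=> i j; rewrite !mxE /= conjCK.
have fS : (map_mx f (S la X) :=: S la X)%MS.
  by apply/eqmxP; rewrite Sf andbT -[X in (_ <= X)%MS]ff map_submx.
set B := row_base (S la X).
rewrite [RHS](@specht_char_basis _ _ _ (map_mx f B) (map_mx f (specht_repr C la X s))) //.
- by rewrite trace_map_mx.
- by rewrite row_free_map row_base_free.
- by apply: eqmx_trans fS; apply/eqmxP; rewrite !map_submx; apply/eqmxP/eq_row_base.
- by rewrite -map_mxM -(map_tabloid_mx la f) -map_mxM specht_base.
Qed.

(** Permuting tabloids preserves the standard Hermitian form. Its Gram matrix [H] on a basis of the
    module is invertible by positivity, and makes the matrix of [s^-1] similar to the conjugate
    transpose of that of [s]. *)
Lemma conj_specht_charV la X s : s \in Sym X ->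
  chi la X s^-1%g = (chi la X s)^*.
Proof.
move=> sX; pose f := @Num.conj C : {rmorphism C -> C}.
set A := specht_repr C la X.
have [B fB BA] : exists2 B : 'M[C]_(\rank (S la X), _), row_free B &
    B *m tmx la s = A s *m B.
  by exists (row_base (S la X)); [apply: row_base_free | apply: specht_base].
pose Bs := (map_mx f B)^T; pose H := B *m Bs.
have H_unit : H \in unitmx.
  rewrite -row_free_unit -kermx_eq0; apply/rowV0P=> v /sub_kermxP vH.
  have : (v *m B) *m (map_mx f (v *m B))^T = 0.
    by rewrite map_mxM trmx_mul !mulmxA -(mulmxA v) vH mul0mx.
  move/matrixP/(_ 0 0); rewrite !mxE.
  under eq_bigr do rewrite !mxE /=.
  move/eqP; rewrite psumr_eq0 => [/allP h|i _]; last exact: mul_conjC_ge0.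
  have vB : v *m B = 0.
    apply/rowP=> j; have := h j (mem_index_enum _); rewrite mul_conjC_eq0 => /eqP vj.
    by rewrite !mxE vj.
  by apply: (row_free_inj fB); rewrite vB mul0mx.
have AH : A s *m H *m (map_mx f (A s))^T = H.
  rewrite /H mulmxA -BA -!mulmxA; congr (_ *m _).
  rewrite /Bs -trmx_mul -map_mxM -BA map_mxM trmx_mul.
  by rewrite map_tabloid_mx tabloid_mx_tr mulmxA -tabloid_mxM mulgV tabloid_mx1 mul1mx.
have AK : A s^-1%g *m A s = 1%:M by rewrite -repr_mxM ?groupV // mulVg repr_mx1.
rewrite /specht_char -/A; move: (A s) (A s^-1%g) AH AK => M N AH AK.
have NE : N = H *m (map_mx f M)^T *m invmx H.
  have <- : N *m H = H *m (map_mx f M)^T by rewrite -{1}AH !mulmxA AK mul1mx.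
  by rewrite mulmxK.
by rewrite NE mxtrace_mulC mulmxA mulVmx // mul1mx mxtrace_tr trace_map_mx.
Qed.

Lemma specht_charV la X s : s \in Sym X -> chi la X s^-1%g = chi la X s.
Proof. by move=> sX; rewrite conj_specht_charV // specht_char_conj. Qed.

Lemma specht_char1 la X : chi la X 1%g = (\rank (S la X))%:R.
Proof. by rewrite /specht_char repr_mx1 mxtrace1. Qed.

Lemma mem_SymJ X (g s : {perm T}) : (g ^ s \in Sym (s @: X))%g = (g \in Sym X).
Proof.
rewrite !inE; apply/subsetP/subsetP=> H x; rewrite inE => gx.
  have : s x \in s @: X by apply: H; rewrite inE permJ (inj_eq perm_inj).
  by rewrite mem_imset //; apply: perm_inj.
rewrite -(permKV s x) mem_imset; last exact: perm_inj.
apply: H; rewrite inE; apply: contraNneq gx => E.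
by rewrite -{1}(permKV s x) permJ E permKV.
Qed.

Lemma is_tableauJ la X (t : {ffun cell la -> T}) (s : {perm T}) :
  is_tableau X t -> is_tableau (s @: X) (tableau_act t s).
Proof.
move=> /andP[/injectiveP injt /eqP <-]; apply/andP; split.
  by apply/injectiveP=> c c'; rewrite !ffunE => /perm_inj/injt.
by apply/eqP; rewrite -imset_comp; apply: eq_imset => c; rewrite /= ffunE.
Qed.

Lemma col_stabJ la X (t : {ffun cell la -> T}) (p s : {perm T}) :
  ((p ^ s)%g \in col_stab (s @: X) (tableau_act t s)) = (p \in col_stab X t).
Proof.
rewrite [LHS]inE [RHS]inE mem_SymJ.
congr (_ && _); apply: eq_forallb => c; apply: eq_existsb => c'.
by rewrite !ffunE permJ (inj_eq perm_inj).
Qed.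

Lemma polytabloidJ la X (t : {ffun cell la -> T}) (s : {perm T}) :
  poly X t *m tmx la s = poly (s @: X) (tableau_act t s).
Proof.
rewrite mulmx_suml [RHS](reindex_inj (conjg_inj s)) /=.
apply: eq_big => [p|p _]; first by rewrite col_stabJ.
rewrite -scalemxAl tabloid_vec_act -tabloid_of_act !tableau_actM -conjgC.
by rewrite odd_permJ.
Qed.

Lemma spechtJ_sub la X (s : {perm T}) : (S la X *m tmx la s <= S la (s @: X))%MS.
Proof.
rewrite sumsmxMr; apply/sumsmx_subP=> t tX.
by rewrite (eqmxMr _ (genmxE _)) polytabloidJ polytabloid_sub ?is_tableauJ.
Qed.

Lemma specht_charJ la X (g s : {perm T}) : g \in Sym X ->
  chi la (s @: X) (g ^ s)%g = chi la X g.
Proof.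
move=> gX; have [B [fB BS BA]] : exists B : 'M[C]_(\rank (S la X), _),
    [/\ row_free B, (B :=: S la X)%MS & B *m tmx la g = specht_repr C la X g *m B].
  exists (row_base (S la X)); split; [exact: row_base_free | exact: eq_row_base |].
  exact: specht_base.
have mK (u : {perm T}) : tmx la u *m tmx la u^-1%g = 1%:M.
  by rewrite -tabloid_mxM mulgV tabloid_mx1.
apply: (@specht_char_basis _ _ _ (B *m tmx la s)).
- apply/row_freeP; have /row_freeP[D BD] := fB.
  by exists (tmx la s^-1%g *m D); rewrite mulmxA -(mulmxA B) mK mulmx1.
- apply: eqmx_trans (eqmxMr _ BS) _; apply/eqmxP.
  rewrite spechtJ_sub -[S la (s @: X)]mulmx1 -(mK s^-1%g) invgK mulmxA submxMr //.
  rewrite (submx_trans (spechtJ_sub _ _ _)) // -imset_comp.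
  by rewrite (eq_imset _ (permK s)) imset_id.
- by rewrite mem_SymJ.
move: (specht_repr C la X g) BA => A BA.
by rewrite -mulmxA -tabloid_mxM conjgE mulKVg tabloid_mxM !mulmxA BA.
Qed.

End SpechtChar.

(** * Branching and completeness *)

Section Branching.

Variables (C : numClosedFieldType) (T : finType).
Implicit Types (X Y : {set T}) (la mu : seq nat).

Local Notation tmx := (tabloid_mx C).
Local Notation vec := (tabloid_vec C).
Local Notation poly X := (polytabloid C X).
Local Notation S la X := (specht_mx C la X).
Local Notation rep la X := (specht_repr C la X).
Local Notation chi la X := (specht_char C la X).

Lemma Sym_sub X Y : X \subset Y -> Sym X \subset Sym Y.
Proof.
by move=> XY; apply/subsetP=> s; rewrite !inE => /subset_trans; apply.
Qed.

Lemma Sym_fix X y s : s \in Sym X -> y \notin X -> s y = y.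
Proof. by rewrite inE => sX yX; apply: out_perm sX yX. Qed.

Section RemoveBox.

Variables (la : seq nat) (i : nat) (X : {set T}) (y : T).
Hypothesis yX : y \notin X.
Let mu := incr_nth la i.
Let Y := y |: X.

Let sle : (size la <= size mu)%N.
Proof. by rewrite size_incr_nth; case: ltnP => // /leqW. Qed.

Let imu : (i < size mu)%N.
Proof. by rewrite size_incr_nth; case: ifP. Qed.

Let mu_row := Ordinal imu.

Definition remove_tabloid (D : tabloid T mu) : tabloid T la :=
  [ffun r => D (widen_ord sle r) :\ y].

(** Erases [y] from the tabloids that have it in the row of the added box, and kills the others. If
    that row is new, [remove_tabloid] drops it altogether. *)
Definition remove_mx : 'M[C]_(#|tabloid T mu|, #|tabloid T la|) :=
  \matrix_a (if y \in (enum_val a : tabloid T mu) mu_row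
             then vec (remove_tabloid (enum_val a)) else 0).

Lemma vec_remove_mx (D : tabloid T mu) : vec D *m remove_mx =
  if y \in D mu_row then vec (remove_tabloid D) else 0.
Proof. by rewrite -rowE rowK enum_rankK. Qed.

Lemma remove_mxJ s : s \in Sym X -> tmx mu s *m remove_mx = remove_mx *m tmx la s.
Proof.
move=> sX; have sy := Sym_fix sX yX.
have ys (A : {set T}) : (y \in s @: A) = (y \in A).
  by rewrite -{1}sy mem_imset //; apply: perm_inj.
apply/row_matrixP=> a; rewrite !row_mul !rowK vec_remove_mx ffunE ys.
case: ifP => _; last by rewrite mul0mx.
rewrite tabloid_vec_act; congr vec; apply/ffunP=> r; rewrite !ffunE.
apply/setP=> x; rewrite 2!inE; apply/andP/imsetP.
  case=> xy /imsetP[z zD xE]; exists z => //; rewrite !inE zD andbT.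
  by apply: contraNneq xy => zy; rewrite xE zy sy.
case=> z; rewrite !inE => /andP[zy zD] ->; split; last exact: imset_f.
by apply: contraNneq zy => E; apply/eqP/(@perm_inj _ s); rewrite E sy.
Qed.

Variables (t : {ffun cell la -> T}) (tX : is_tableau X t).

(** Cells of [la] and of [mu] have different types, hence the matching by coordinates; the one
    unmatched cell receives [y]. *)
Definition add_entry : {ffun cell mu -> T} :=
  [ffun c : cell mu =>
     if [pick d : cell la | (cell_row d == cell_row c)
                            && (cell_col d == cell_col c)]
     is Some d then t d else y].

Let nmu r : part_nth mu r = ((i == r) + part_nth la r)%N.
Proof. exact: nth_incr_nth. Qed.

Let embP (d : cell la) : exists c : cell mu,
  [/\ cell_row c = cell_row d, cell_col c = cell_col d & add_entry c = t d].
Proof.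
have [|c [E1 E2]] := @cell_exists mu (cell_row d) (cell_col d).
  by rewrite nmu (leq_trans (cell_col_lt d)) // leq_addl.
exists c; split=> //; rewrite ffunE; case: pickP => [d' /andP[/eqP F1 /eqP F2]|].
  by congr (t _); apply: cell_eqP; rewrite ?F1 ?F2.
by move/(_ d); rewrite E1 E2 !eqxx.
Qed.

Let corner : exists c : cell mu,
  [/\ cell_row c = i, cell_col c = part_nth la i & add_entry c = y].
Proof.
have [|c [E1 E2]] := @cell_exists mu i (part_nth la i).
  by rewrite nmu eqxx.
exists c; split=> //; rewrite ffunE; case: pickP => // d /andP[/eqP F1 /eqP F2].
by have := cell_col_lt d; rewrite F1 F2 E1 E2 ltnn.
Qed.

Let cellP (c : cell mu) :
  (exists d : cell la,
     [/\ cell_row d = cell_row c, cell_col d = cell_col c & add_entry c = t d])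
  \/ [/\ cell_row c = i, cell_col c = part_nth la i & add_entry c = y].
Proof.
have := cell_col_lt c; rewrite nmu => lt.
case: (ltnP (cell_col c) (part_nth la (cell_row c))) => h.
  have [d [E1 E2]] := cell_exists h; left; exists d; split=> //.
  have [c' [F1 F2 F3]] := embP d; rewrite -F3; congr (add_entry _).
  by apply: cell_eqP; rewrite ?F1 ?F2.
have [c0 [E1 E2 E3]] := corner; right.
have ir : i = cell_row c.
  by apply/eqP; move: lt; case: eqP => // _; rewrite add0n ltnNge h.
have F2 : cell_col c = part_nth la i.
  by apply/eqP; rewrite eqn_leq {2}ir h andbT; move: lt; rewrite -ir eqxx ltnS.
by split=> //; rewrite -E3; congr (add_entry _); apply: cell_eqP; rewrite ?E1 ?E2.
Qed.

Let tny d : t d != y.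
Proof. by apply: contraNneq yX => <-; apply: tableau_mem. Qed.

Lemma add_entry_tableau : is_tableau Y add_entry.
Proof.
apply/andP; split.
  apply/injectiveP=> c c'.
  case: (cellP c) => [[d [E1 E2 ->]]|[E1 E2 ->]];
  case: (cellP c') => [[d' [F1 F2 ->]]|[F1 F2 ->]].
  - by move/(tableau_inj tX) => E; apply: cell_eqP; rewrite -?E1 -?E2 E.
  - by move/eqP; rewrite (negPf (tny _)).
  - by move/esym/eqP; rewrite (negPf (tny _)).
  - by move=> _; apply: cell_eqP; rewrite ?E1 ?E2.
apply/eqP/setP=> x; apply/imsetP/idP => [[c _ ->]|].
  case: (cellP c) => [[d [_ _ ->]]|[_ _ ->]]; last by rewrite !inE eqxx.
  by rewrite !inE (tableau_mem _ tX) orbT.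
rewrite !inE => /orP[/eqP ->|/(tableau_onto tX)[d <-]].
  by have [c [_ _ <-]] := corner; exists c.
by have [c [_ _ <-]] := embP d; exists c.
Qed.

Let t'X := add_entry_tableau.

(** The corner is the only cell in both its row and its column, so a column permutation that keeps
    [y] in its row fixes [y]. *)
Lemma remove_col_stab q : (q \in col_stab X t) =
  (q \in col_stab Y add_entry) && (y \in tabloid_of (tableau_act add_entry q) mu_row).
Proof.
have [c0 [R0 C0 T0]] := corner; have it := tableau_inj t'X.
apply/idP/andP => [/col_stabP[qX H]|[/col_stabP[qY H] yq]].
  have qy := Sym_fix qX yX; split.
    apply/col_stabP; split; first by apply: subsetP qX; apply/Sym_sub/subsetUr.
    move=> c; case: (cellP c) => [[d [E1 E2 ->]]|[E1 E2 ->]].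
      have [d' F1 ->] := H d; have [c' [_ G2 <-]] := embP d'.
      by exists c' => //; rewrite G2 F1.
    by exists c0; rewrite ?qy ?C0.
  rewrite ffunE; apply/imsetP; exists c0; last by rewrite ffunE T0 qy.
  by rewrite inE; apply/eqP/val_inj.
have qy : q y = y.
  move: yq; rewrite ffunE => /imsetP[c]; rewrite inE ffunE => /eqP cr yE.
  have [c' E1 E2] := H c; have c'0 : c' = c0 by apply: it; rewrite -E2 -yE T0.
  suff cc0 : c = c0 by rewrite {2}yE cc0 T0.
  by apply: cell_eqP; rewrite ?R0 ?C0 -?E1 ?c'0 ?C0 // /cell_row cr.
apply/col_stabP; split.
  move: qY; rewrite !inE => /subsetP qY; apply/subsetP=> x xq.
  have := qY x xq; rewrite in_setU1; case: eqP => // xy.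
  by move: xq; rewrite inE xy qy eqxx.
move=> d; have [c [E1 E2 E3]] := embP d; have [c' F1 F2] := H c.
case: (cellP c') => [[d' [G1 G2 G3]]|[_ _ G3]].
  by exists d'; rewrite ?G2 ?F1 // -E3 F2 G3.
by case/eqP: (tny d); apply: (@perm_inj _ q); rewrite qy -E3 F2.
Qed.

Lemma remove_tabloidE q : q \in Sym X ->
  remove_tabloid (tabloid_of (tableau_act add_entry q)) =
  tabloid_of (tableau_act t q).
Proof.
move=> qX; have qy := Sym_fix qX yX.
apply/ffunP=> r; rewrite !ffunE; apply/setP=> x; rewrite in_setD1.
apply/andP/imsetP => [[xy /imsetP[c]]|[d]]; rewrite inE => /eqP cr; rewrite ffunE => xE.
  case: (cellP c) => [[d [E1 E2 E3]]|[_ _ E3]]; last first.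
    by move: xy; rewrite xE E3 qy eqxx.
  exists d; last by rewrite ffunE xE E3.
  by rewrite inE; apply/eqP/val_inj; rewrite /= -[LHS]/(cell_row d) E1 /cell_row cr.
have [c [E1 E2 E3]] := embP d; split.
  apply: contraNneq (tny d) => xy; apply/eqP/(@perm_inj _ q).
  by rewrite qy -xE xy.
apply/imsetP; exists c; last by rewrite ffunE xE E3.
by rewrite inE; apply/eqP/val_inj; rewrite /= -[LHS]/(cell_row c) E1 /cell_row cr.
Qed.

(** By [remove_col_stab] the terms that survive are those of the smaller polytabloid; hence the map
    is nonzero on the larger Specht module. *)
Lemma polytabloid_remove : poly Y add_entry *m remove_mx = poly X t.
Proof.
rewrite mulmx_suml [RHS]/polytabloid.
rewrite [RHS](eq_bigl _ _ remove_col_stab) big_mkcondr.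
apply: eq_bigr => q qC; rewrite -scalemxAl vec_remove_mx; case: ifP => yq.
  rewrite remove_tabloidE //; have : q \in col_stab X t by rewrite remove_col_stab qC.
  by case/col_stabP.
by rewrite scaler0.
Qed.

End RemoveBox.

Definition specht_mult la X mu Y (XY : X \subset Y) : nat :=
  hom_dim (subg_repr (rep mu Y) (Sym_sub XY)) (rep la X).

Lemma sum_specht_mult la X mu Y (XY : X \subset Y) :
  \sum_(s in Sym X) chi mu Y s * chi la X s =
  #|Sym X|%:R * (specht_mult la mu XY)%:R.
Proof.
rewrite /specht_mult -sum_mxtrace_hom_dim; apply: eq_bigr => s sX; congr (_ * _).
by rewrite -specht_charV //; apply: subsetP (Sym_sub XY) _ sX.
Qed.

(** [R] is only known to send the one vector [e'] into [S la X], and [in_submod] need not be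
    equivariant, so the composite [B] is averaged. No term of the average alters the image of [e']:
    [R] commutes with [Sym X], and the translates of [e'] by [Sym X] are sent into [S la X]. *)
Lemma specht_mult_gt0 k la mu X Y (XY : X \subset Y) y :
    is_partition_of k la -> covers la mu -> #|X| = k -> Y = y |: X -> y \notin X ->
  (0 < specht_mult la mu XY)%N.
Proof.
move=> pl; case/hasP=> i _ /eqP -> Xk YE yX.
move: XY; rewrite {Y}YE => XY.
have [|t tX] := @tableau_exists T X la; first by case/and3P: pl => _ _ /eqP ->.
set mu' := incr_nth la i in XY *; set Y := y |: X in XY *.
have t'X : is_tableau Y (add_entry i y t) by apply: add_entry_tableau.
have e'R := polytabloid_remove i yX tX.
set e' := poly Y _ in e'R; set R := remove_mx la i y in e'R.
have e'S : (e' <= S mu' Y)%MS by apply: polytabloid_sub.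
have RJ s : s \in Sym X -> tmx mu' s *m R = R *m tmx la s by apply: remove_mxJ.
pose B : 'M[C]_(\rank (S mu' Y), \rank (S la X)) :=
  val_submod 1%:M *m R *m in_submod (S la X) 1%:M.
pose r1 := subg_repr (rep mu' Y) (Sym_sub XY).
apply: (@hom_dim_gt0 _ _ _ _ _ _ _ (average r1 (rep la X) B)).
  exact: average_intertwines.
apply/eqP => A0; have := polytabloid_neq0 C tX.
rewrite -(in_submodK (polytabloid_sub C tX)).
rewrite val_submod_eq0 => /eqP[].
suff <- : in_submod (S mu' Y) e' *m average r1 (rep la X) B =
    in_submod (S la X) (poly X t).
  by rewrite A0 mulmx0.
rewrite /average -scalemxAr mulmx_sumr (eq_bigr (fun=> in_submod (S la X) (poly X t))).
  by rewrite sumr_const -scaler_nat scalerA mulVf ?card_neq0 ?scale1r.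
move=> g gX; have gX' : g^-1%g \in Sym X by rewrite groupV.
have e1 : in_submod (S mu' Y) e' *m r1 g^-1%g =
    in_submod (S mu' Y) (e' *m tmx mu' g^-1%g).
  by rewrite (in_submodJ (specht_module C mu' Y)).
have e'gS : (e' *m tmx mu' g^-1%g <= S mu' Y)%MS.
  have /mxmoduleP/(_ g^-1%g) H := specht_module C mu' Y.
  by apply: submx_trans (submxMr _ e'S) (H _); apply: subsetP (Sym_sub XY) _ gX'.
have e2 : in_submod (S mu' Y) (e' *m tmx mu' g^-1%g) *m B =
    in_submod (S la X) (poly X t *m tmx la g^-1%g).
  rewrite /B -[val_submod _ *m R *m _]mulmxA [LHS]mulmxA -val_submodE in_submodK //.
  by rewrite [LHS]mulmxA -(mulmxA e') RJ // (mulmxA e') e'R -in_submodE.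
have etS : (poly X t *m tmx la g^-1%g <= S la X)%MS.
  have /mxmoduleP/(_ g^-1%g) H := specht_module C la X.
  by apply: submx_trans (submxMr _ (polytabloid_sub C tX)) (H _).
rewrite -[r1 _ *m B *m _]mulmxA [LHS]mulmxA e1 [LHS]mulmxA e2.
have <- := in_submodJ (specht_module C la X) g etS.
by rewrite -mulmxA -tabloid_mxM mulVg tabloid_mx1 mulmx1.
Qed.

Lemma specht_orthogonal k la mu X g :
    is_partition_of k la -> is_partition_of k mu -> #|X| = k -> g \in Sym X ->
  \sum_(s in Sym X) chi la X s * chi mu X (s * g)%g =
  (la == mu)%:R * (#|Sym X|%:R / (\rank (S la X))%:R * chi la X g).
Proof.
move=> pl pm Xk gX.
have trM nu s : s \in Sym X -> \tr (rep nu X s *m rep nu X g) = chi nu X (s * g)%g.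
  by move=> sX; rewrite -repr_mxM.
case: eqP => [<-|/eqP ne]; rewrite ?mul1r ?mul0r.
  rewrite -[RHS](@sum_mxtrace_scalar _ _ _ _ (rep la X) (rep la X g)).
  - by apply: eq_bigr => s sX; rewrite trM // -specht_charV.
  - by move=> A; apply: specht_hom_scalar pl.
  by apply: specht_rank_gt0; case/and3P: pl => _ _ /eqP ->.
case: (leqP (row_weight mu) (row_weight la)) => wle.
  rewrite -[RHS](@sum_mxtrace_no_intertwiner _ _ _ _ _ (rep la X) (rep mu X) (rep mu X g)).
    by apply: eq_bigr => s sX; rewrite trM // -specht_charV.
  by move=> A; apply: specht_hom_neq pl pm ne wle.
(* Here only maps from [mu] to [la] are known to vanish. The substitution of [(g * s)^-1] for [s]
   exchanges the two characters, which are invariant under inversion. *)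
rewrite -[RHS](@sum_mxtrace_no_intertwiner _ _ _ _ _ (rep mu X) (rep la X) (rep la X g)).
  rewrite (reindex_inj invg_inj) (reindex_inj (mulgI g)) /=.
  apply: eq_big => [s|s]; first by rewrite groupV groupMl.
  rewrite groupV groupMl // => sX; rewrite trM // mulrC invMg mulgKV -invMg.
  congr (_ * _); rewrite specht_charV ?groupM // /specht_char !repr_mxM //.
  exact: mxtrace_mulC.
by move=> A; apply: specht_hom_neq pm pl _ (ltnW wle); rewrite eq_sym.
Qed.

End Branching.

(** * Dimensions, completeness and multiplicities *)

Section Completeness.

Variables (C : numClosedFieldType) (T : finType).
Implicit Types (X Y : {set T}) (la mu : seq nat).

Local Notation rep la X := (specht_repr C la X).
Local Notation chi la X := (specht_char C la X).
Local Notation f la X := (\rank (specht_mx C la X)).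

Lemma specht_rank_parts_gt0 k la X : la \in parts k -> #|X| = k -> (0 < f la X)%N.
Proof.
by rewrite mem_parts => /and3P[_ _ /eqP <-] Xk; apply: specht_rank_gt0.
Qed.

Lemma specht_orthonormal k la mu X :
    la \in parts k -> mu \in parts k -> #|X| = k ->
  \sum_(s in Sym X) chi la X s * chi mu X s = (la == mu)%:R * #|Sym X|%:R.
Proof.
move=> lk mk Xk; have f0 := specht_rank_parts_gt0 lk Xk.
rewrite !mem_parts in lk mk.
have := specht_orthogonal C lk mk Xk (group1 (Sym_group X)).
under eq_bigr do rewrite mulg1; move=> ->; congr (_ * _).
by rewrite specht_char1 divfK // pnatr_eq0 -lt0n.
Qed.

(* The sum of the squares of [N * (g == 1) - \sum_la f_la * chi_la g] is
   [N * (N - \sum_la f_la ^ 2)], where [N] is the order of the group. *)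
Lemma specht_complete_of_rank k X : #|X| = k ->
    {in parts k, forall la, (num_syt k la <= f la X)%N} ->
  {in parts k, forall la, f la X = num_syt k la} /\
  {in Sym X, forall g, \sum_(la <- parts k) (f la X)%:R * chi la X g =
                       #|Sym X|%:R * (g == 1%g)%:R}.
Proof.
move=> Xk lb; set N : C := #|Sym X|%:R.
pose psi g := \sum_(la <- parts k) (f la X)%:R * chi la X g.
pose h g := N * (g == 1%g)%:R - psi g.
pose Q := (\sum_(la <- parts k) f la X ^ 2)%N.
have N0 : 0 < N by rewrite ltr0n card_Sym fact_gt0.
have h2 : \sum_(g in Sym X) h g ^+ 2 = N * (N - Q%:R).
  have E1 : \sum_(g in Sym X) psi g ^+ 2 = N * Q%:R.
    rewrite /Q natr_sum mulr_sumr.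
    under eq_bigr do rewrite expr2 mulr_suml.
    rewrite exchange_big /= !big_seq; apply: eq_bigr => la lk.
    under eq_bigr do rewrite mulr_sumr.
    rewrite exchange_big /= (bigD1_seq la) ?parts_uniq //= [X in _ + X]big1_seq ?addr0.
      under eq_bigr do rewrite mulrACA.
      by rewrite -mulr_sumr (specht_orthonormal lk lk Xk) eqxx mul1r mulrC natrX expr2.
    move=> mu /andP[ne mk]; under eq_bigr do rewrite mulrACA.
    by rewrite -mulr_sumr (specht_orthonormal lk mk Xk) eq_sym (negPf ne) mul0r mulr0.
  have E2 : \sum_(g in Sym X) N * (g == 1%g)%:R * psi g = N * Q%:R.
    rewrite (bigD1 1%g) ?group1 //= eqxx mulr1 big1 ?addr0.
      rewrite /psi /Q natr_sum; congr (_ * _); apply: eq_bigr => la _.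
      by rewrite specht_char1 natrX expr2.
    by move=> g /andP[_ /negPf ->]; rewrite mulr0 mul0r.
  have E3 : \sum_(g in Sym X) (N * (g == 1%g)%:R) ^+ 2 = N * N.
    rewrite (bigD1 1%g) ?group1 //= eqxx mulr1 big1 ?addr0 //.
    by move=> g /andP[_ /negPf ->]; rewrite mulr0 expr0n.
  under eq_bigr do rewrite sqrrB.
  rewrite big_split sumrB /= E1 E3 sumrMnl E2 mulrBr.
  by rewrite mulr2n opprD addrA subrK.
(* Characters are real, so this square is a squared modulus. *)
have h2_ge0 g : g \in Sym X -> 0 <= h g ^+ 2.
  move=> gX; suff hr : (h g)^* = h g by rewrite expr2 -{2}hr mul_conjC_ge0.
  rewrite rmorphB rmorphM !rmorph_nat rmorph_sum; congr (_ - _).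
  by apply: eq_bigr => la _; rewrite rmorphM rmorph_nat /= specht_char_conj.
have QN : (Q <= k`!)%N.
  have : 0 <= N * (N - Q%:R) by rewrite -h2 sumr_ge0.
  by rewrite pmulr_rge0 // subr_ge0 ler_nat card_Sym Xk.
have lb2 la : la \in parts k -> (num_syt k la ^ 2 <= f la X ^ 2)%N.
  by move/lb; rewrite leq_sqr.
have QE : (\sum_(la <- parts k | la \in parts k) (f la X ^ 2 - num_syt k la ^ 2) = 0)%N.
  apply/eqP; rewrite sumnB // -!big_seq sum_num_syt_sqr subn_eq0; exact: QN.
have Qk : Q = k`!.
  apply/eqP; rewrite eqn_leq QN -sum_num_syt_sqr /Q big_seq [leqRHS]big_seq /=.
  exact: leq_sum.
split=> [la lk|g gX].
  apply/eqP; rewrite eqn_leq lb // andbT -leq_sqr -subn_eq0.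
  move/eqP: QE; rewrite -big_seq sum_nat_seq_eq0 => /allP/(_ la lk).
  by [].
apply/eqP; rewrite eq_sym -subr_eq0 -[_ - _]/(h g) -sqrf_eq0.
have : \sum_(g in Sym X) h g ^+ 2 == 0.
  by rewrite h2 Qk /N card_Sym Xk subrr mulr0.
by rewrite psumr_eq0 // => /allP/(_ g (mem_index_enum _)); rewrite gX.
Qed.

(** The hypothesis identifies the regular character of [Sym X]. Pairing it with the restriction of
    [chi mu Y] gives the dimension on one side and the multiplicities on the other. *)
Lemma sum_specht_mult_rank k mu X Y (XY : X \subset Y) : #|X| = k ->
    {in Sym X, forall g, \sum_(la <- parts k) (f la X)%:R * chi la X g =
                       #|Sym X|%:R * (g == 1%g)%:R} ->
  f mu Y = (\sum_(la <- parts k) f la X * specht_mult C la mu XY)%N.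
Proof.
move=> Xk H; apply/eqP; rewrite -(eqr_nat C) -specht_char1.
have N0 : #|Sym X|%:R != 0 :> C by rewrite pnatr_eq0 -lt0n cardG_gt0.
apply/eqP/(mulfI N0).
transitivity (\sum_(g in Sym X) chi mu Y g *
    (\sum_(la <- parts k) (f la X)%:R * chi la X g)).
  rewrite (bigD1 1%g) ?group1 //= H ?group1 // eqxx mulr1 mulrC big1 ?addr0 //.
  by move=> g /andP[gX /negPf g1]; rewrite H // g1 !mulr0.
under [in LHS]eq_bigr do rewrite mulr_sumr.
rewrite exchange_big natr_sum mulr_sumr /=; apply: eq_bigr => la _.
under eq_bigr do rewrite mulrCA.
by rewrite -mulr_sumr sum_specht_mult natrM mulrCA.
Qed.

(** The multiplicity of each shape below [mu] is at least 1, so completeness for [Y :\ y] bounds the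
    rank from below by the recursion of [num_syt]; [specht_complete_of_rank] turns this bound into
    an equality. *)
Theorem specht_complete k X : #|X| = k ->
  {in parts k, forall la, f la X = num_syt k la} /\
  {in Sym X, forall g, \sum_(la <- parts k) (f la X)%:R * chi la X g =
                       #|Sym X|%:R * (g == 1%g)%:R}.
Proof.
elim: k X => [|k IH] Y Yk; apply: specht_complete_of_rank => // mu mk.
  exact: specht_rank_parts_gt0 mk Yk.
have /set0Pn[y yY] : Y != set0 by rewrite -card_gt0 Yk.
have XY : Y :\ y \subset Y by apply: subD1set.
have Xk : #|Y :\ y| = k by have := cardsD1 y Y; rewrite yY Yk add1n => -[].
have [fE H] := IH _ Xk; rewrite (sum_specht_mult_rank mu XY Xk H) num_sytS.
rewrite big_mkcond big_seq [leqRHS]big_seq; apply: leq_sum => la lk.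
case: ifP => // c; rewrite fE // leq_pmulr //.
apply: (@specht_mult_gt0 _ _ k _ _ _ _ _ y) => //.
- by rewrite -mem_parts.
- by rewrite setD1K.
- by rewrite !inE eqxx.
Qed.

(** Each multiplicity is at least [covers nu mu], yet both families, weighted by the positive ranks,
    add up to the rank of [S^mu]; so they agree term by term. *)
Lemma sum_specht_char_branch k la mu X Y y :
    la \in parts k -> mu \in parts k.+1 -> #|X| = k -> Y = y |: X -> y \notin X ->
  \sum_(s in Sym X) chi mu Y s * chi la X s = (covers la mu)%:R * #|Sym X|%:R.
Proof.
move=> lk mk Xk YE yX.
have XY : X \subset Y by rewrite YE subsetUr.
have Yk : #|Y| = k.+1 by rewrite YE cardsU1 yX Xk.
rewrite (sum_specht_mult _ _ _ XY) mulrC; congr (_%:R * _).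
have [fE H] := specht_complete Xk; have [fY _] := specht_complete Yk.
have m1 nu : nu \in parts k -> (covers nu mu <= specht_mult C nu mu XY)%N.
  move=> nk; case c: (covers nu mu) => //.
  by apply: (@specht_mult_gt0 _ _ k _ _ _ _ _ y) => //; rewrite -mem_parts.
have : (\sum_(nu <- parts k | nu \in parts k)
         (f nu X * specht_mult C nu mu XY - f nu X * covers nu mu) = 0)%N.
  apply/eqP; rewrite sumnB; last by move=> nu nk; rewrite leq_mul2l m1 ?orbT.
  rewrite -!big_seq -(sum_specht_mult_rank mu XY Xk H) fY // num_sytS subn_eq0.
  rewrite [leqLHS]big_mkcond [leqLHS]big_seq [leqRHS]big_seq; apply: leq_sum => nu nk.
  by rewrite fE //; case: (covers nu mu); rewrite ?muln1.
move/eqP; rewrite -big_seq sum_nat_seq_eq0 => /allP/(_ la lk) /=.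
rewrite -mulnBr muln_eq0 -leqn0 leqNgt (specht_rank_parts_gt0 lk Xk) /= subn_eq0 => le.
by apply/eqP; rewrite eqn_leq le m1.
Qed.

End Completeness.

(** * Positivity *)

Section Psd.

Local Open Scope sesquilinear_scope.

Variables (R : realType) (d : nat).
Local Notation C := R[i].
Implicit Types M N : 'M[C]_d.

Lemma psdmxP M : psdmx M <->
  M ^t* = M /\ forall v : 'rV[C]_d, 0 <= (v *m M *m v ^t*) 0 0.
Proof.
rewrite /psdmx; split=> -[H1 H2]; split=> //.
  by move/is_hermitianmxP: H1; rewrite expr0 scale1r => <-.
by apply/is_hermitianmxP; rewrite expr0 scale1r.
Qed.

Lemma adjmxM m n p (A : 'M[C]_(m, n)) (B : 'M[C]_(n, p)) :
  (A *m B) ^t* = B ^t* *m A ^t*.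
Proof. by rewrite trmx_mul map_mxM. Qed.

Lemma psdmx0 : psdmx (0 : 'M[C]_d).
Proof.
apply/psdmxP; split=> [|v]; first by rewrite trmx0 map_mx0.
by rewrite mulmx0 mul0mx mxE.
Qed.

Lemma psdmxD M N : psdmx M -> psdmx N -> psdmx (M + N).
Proof.
move=> /psdmxP[M1 M2] /psdmxP[N1 N2]; apply/psdmxP; split=> [|v].
  by rewrite linearD /= map_mxD M1 N1.
by rewrite mulmxDr mulmxDl mxE addr_ge0.
Qed.

Lemma psdmxZ a M : 0 <= a -> psdmx M -> psdmx (a *: M).
Proof.
move=> a0 /psdmxP[M1 M2]; apply/psdmxP; split=> [|v].
  by rewrite linearZ /= map_mxZ M1 /= geC0_conj.
by rewrite -scalemxAr -scalemxAl mxE mulr_ge0.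
Qed.

Lemma psdmx_sum (I : Type) (r : seq I) (P : pred I) (F : I -> 'M[C]_d) :
  (forall i, P i -> psdmx (F i)) -> psdmx (\sum_(i <- r | P i) F i).
Proof. by move=> H; apply: big_ind => //; [apply: psdmx0 | apply: psdmxD]. Qed.

Lemma psdmx_proj M : M ^t* = M -> M *m M = M -> psdmx M.
Proof.
move=> M1 MM; apply/psdmxP; split=> // v.
have -> : v *m M *m v ^t* = (v *m M) *m (v *m M) ^t*.
  by rewrite adjmxM M1 -[RHS]mulmxA (mulmxA M) MM [RHS]mulmxA.
by rewrite mxE sumr_ge0 // => i _; rewrite !mxE mul_conjC_ge0.
Qed.

End Psd.

(** * Character sums and isotypic projections in a representation *)

Section SpechtSums.

Variables (C : numClosedFieldType) (T : finType).
Implicit Types (X Y : {set T}) (la mu : seq nat).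

Local Notation rep la X := (specht_repr C la X).
Local Notation chi la X := (specht_char C la X).
Local Notation f la X := (\rank (specht_mx C la X)).

(** [r] is a bare function, assumed multiplicative only on the subgroup in use, so that the same
    identities serve for a Specht module of [Sym Y] and for a representation of the full symmetric
    group. *)
Definition specht_sum d (r : {perm T} -> 'M[C]_d) la X : 'M[C]_d :=
  \sum_(s in Sym X) chi la X s *: r s.

Definition specht_proj d (r : {perm T} -> 'M[C]_d) la X : 'M[C]_d :=
  ((f la X)%:R / #|Sym X|%:R) *: specht_sum r la X.

Lemma card_Sym_neq0 X : #|Sym X|%:R != 0 :> C.
Proof. by rewrite pnatr_eq0 -lt0n cardG_gt0. Qed.

Section Products.

Variables (d : nat) (r : {perm T} -> 'M[C]_d) (k : nat) (Y : {set T}).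
Hypothesis rM : {in Sym Y &, forall s t, r (s * t)%g = r s *m r t}.

(** After multiplication by the character sum of [mu], an element matters only through its action on
    [S^mu]; identities in [r] thus reduce to identities in Specht modules. *)
Lemma mul_specht_sum (a : {perm T} -> C) mu X : X \subset Y ->
  (\sum_(s in Sym X) a s *: r s) *m specht_sum r mu Y =
  \sum_(g in Sym Y)
    \tr ((\sum_(s in Sym X) a s *: rep mu Y s^-1%g) *m rep mu Y g) *: r g.
Proof.
move=> XY; have sXY s : s \in Sym X -> s \in Sym Y by apply/subsetP/Sym_sub.
transitivity (\sum_(s in Sym X) \sum_(g in Sym Y)
    (a s * chi mu Y (s^-1 * g)%g) *: r g).
  rewrite mulmx_suml; apply: eq_bigr => s /sXY sY.
  rewrite mulmx_sumr (reindex_inj (mulgI s^-1%g)) /=.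
  apply: eq_big => [g|g]; first by rewrite groupMl ?groupV.
  rewrite groupMl ?groupV // => gY.
  by rewrite -scalemxAl -scalemxAr scalerA -rM ?groupMl ?groupV // mulKVg.
rewrite exchange_big /=; apply: eq_bigr => g gY; rewrite -scaler_suml; congr (_ *: _).
rewrite mulmx_suml linear_sum /=; apply: eq_bigr => s /sXY sY.
by rewrite -scalemxAl linearZ /= -repr_mxM ?groupV.
Qed.

Hypothesis Yk : #|Y| = k.

Lemma mul_specht_sum_eq la mu : la \in parts k -> mu \in parts k ->
  specht_sum r la Y *m specht_sum r mu Y =
  ((la == mu)%:R * (#|Sym Y|%:R / (f la Y)%:R)) *: specht_sum r la Y.
Proof.
rewrite !mem_parts => pl pm; rewrite mul_specht_sum // scaler_sumr.
apply: eq_bigr => g gY; rewrite scalerA; congr (_ *: _).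
rewrite -mulrA -(specht_orthogonal C pl pm Yk gY) mulmx_suml linear_sum /=.
rewrite [RHS](reindex_inj invg_inj) /=.
apply: eq_big => [s|s sY]; first by rewrite groupV.
by rewrite -scalemxAl linearZ /= -repr_mxM ?groupV // specht_charV.
Qed.

Lemma mul_specht_proj la mu : la \in parts k -> mu \in parts k ->
  specht_proj r la Y *m specht_proj r mu Y = (la == mu)%:R *: specht_proj r la Y.
Proof.
move=> lk mk; have f0 := specht_rank_parts_gt0 C lk Yk.
rewrite -scalemxAl -scalemxAr mul_specht_sum_eq // !scalerA.
case: (eqVneq la mu) => [<-|_]; last by rewrite !(mul0r, mulr0).
congr (_ *: _); have N0 := card_Sym_neq0 Y.
have f0' : (f la Y)%:R != 0 :> C by rewrite pnatr_eq0 -lt0n.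
by rewrite !mul1r; field; rewrite f0' N0.
Qed.

Lemma sum_specht_proj : r 1%g = 1%:M -> \sum_(la <- parts k) specht_proj r la Y = 1%:M.
Proof.
move=> r1; rewrite /specht_proj /specht_sum.
under eq_bigr do rewrite scaler_sumr.
rewrite exchange_big (bigD1 1%g) ?group1 //= [X in _ + X]big1 ?addr0 => [|g /andP[gY g1]].
  rewrite r1.
  under eq_bigr do rewrite scalerA.
  rewrite -scaler_suml -[RHS]scale1r; congr (_ *: _).
  under eq_bigr do rewrite mulrAC.
  rewrite -mulr_suml (specht_complete C Yk).2 ?group1 // eqxx mulr1.
  by rewrite divff ?card_Sym_neq0.
under eq_bigr do rewrite scalerA.
rewrite -scaler_suml; under eq_bigr do rewrite mulrAC.
by rewrite -mulr_suml (specht_complete C Yk).2 // (negPf g1) mulr0 mul0r scale0r.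
Qed.

End Products.

Lemma trace_specht_sum k la mu X Y y :
    la \in parts k -> mu \in parts k.+1 -> #|X| = k -> Y = y |: X -> y \notin X ->
  \tr (specht_sum (rep mu Y) la X) = (covers la mu)%:R * #|Sym X|%:R.
Proof.
move=> lk mk Xk YE yX; rewrite -(sum_specht_char_branch C lk mk Xk YE yX).
by rewrite linear_sum; apply: eq_bigr => s _; rewrite /= linearZ mulrC.
Qed.

(** It is a nonzero multiple of an idempotent, whose rank is its trace, and the trace is 0 by
    branching. *)
Lemma specht_sum_not_covers k la mu X Y y :
    la \in parts k -> mu \in parts k.+1 -> #|X| = k -> Y = y |: X -> y \notin X ->
    ~~ covers la mu ->
  specht_sum (rep mu Y) la X = 0.
Proof.
move=> lk mk Xk YE yX nc; have f0 := specht_rank_parts_gt0 C lk Xk.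
have XY : X \subset Y by rewrite YE subsetUr.
have rM : {in Sym X &, forall s t, rep mu Y (s * t)%g = rep mu Y s *m rep mu Y t}.
  by move=> s t sX tX; rewrite repr_mxM //; apply: subsetP (Sym_sub XY) _ _.
have := mul_specht_proj rM Xk lk lk; rewrite eqxx scale1r => /mxtrace_idem.
rewrite /specht_proj linearZ /= (trace_specht_sum lk mk Xk YE yX) (negPf nc).
rewrite mul0r mulr0 => /esym/eqP; rewrite pnatr_eq0 mxrank_eq0 scaler_eq0.
by rewrite mulf_eq0 invr_eq0 (negPf (card_Sym_neq0 X)) orbF pnatr_eq0 eqn0Ngt f0 => /eqP.
Qed.

Lemma specht_sum_invE d (r : {perm T} -> 'M[C]_d) la X :
  \sum_(s in Sym X) chi la X s *: r s^-1%g = specht_sum r la X.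
Proof.
rewrite /specht_sum (reindex_inj invg_inj) /=.
apply: eq_big => [s|s sX]; first by rewrite groupV.
by rewrite invgK specht_charV // -groupV.
Qed.

Lemma specht_sumJ d (r : {perm T} -> 'M[C]_d) la X Y h :
    {in Sym Y &, forall s t, r (s * t)%g = r s *m r t} ->
    X \subset Y -> h \in Sym Y ->
  specht_sum r la X *m r h = r h *m specht_sum r la (h @: X).
Proof.
move=> rM XY hY; have sXY s : s \in Sym X -> s \in Sym Y by apply/subsetP/Sym_sub.
rewrite mulmx_suml mulmx_sumr [RHS](reindex_inj (conjg_inj h)) /=.
apply: eq_big => [s|s sX]; first by rewrite mem_SymJ.
have sY := sXY s sX.
by rewrite -scalemxAl -scalemxAr specht_charJ // -!rM ?groupJ // -conjgC.
Qed.

Lemma imset_Sym Y h : h \in Sym Y -> h @: Y = Y.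
Proof. by rewrite inE => /im_perm_on. Qed.

Lemma imset_SymD1 Y h b : h \in Sym Y -> h @: (Y :\ b) = Y :\ h b.
Proof.
move=> hY; apply/setP=> x; rewrite !inE -{2}(imset_Sym hY).
apply/imsetP/andP => [[z]|[xb /imsetP[z zY xE]]].
  by rewrite !inE => /andP[zb zY] ->; rewrite (inj_eq perm_inj) zb imset_f.
by exists z => //; rewrite !inE zY andbT; apply: contraNneq xb => <-; rewrite xE.
Qed.

(* The left side is central in the group algebra of [Sym Y], so it acts on each
   Specht module by a scalar, read off from the trace. *)
Lemma sum_specht_sum_branch d (r : {perm T} -> 'M[C]_d) k la Y :
    {in Sym Y &, forall s t, r (s * t)%g = r s *m r t} -> r 1%g = 1%:M ->
    la \in parts k -> #|Y| = k.+1 ->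
  \sum_(b in Y) specht_sum r la (Y :\ b) =
  \sum_(mu <- parts k.+1 | covers la mu) specht_sum r mu Y.
Proof.
move=> rM r1 lk Yk; set Z := LHS.
have Yb b : b \in Y -> [/\ #|Y :\ b| = k, Y = b |: (Y :\ b) & b \notin Y :\ b].
  move=> bY; rewrite setD1K // !inE eqxx; split=> //.
  by have := cardsD1 b Y; rewrite bY Yk add1n => -[].
(* Inserting the resolution of the identity lets each isotypic part be treated separately. *)
rewrite -[LHS]mulmx1 -(sum_specht_proj Yk r1) mulmx_sumr [RHS]big_mkcond.
rewrite !big_seq; apply: eq_bigr => mu mk; have f0 := specht_rank_parts_gt0 C mk Yk.
have f0' : (f mu Y)%:R != 0 :> C by rewrite pnatr_eq0 -lt0n.
pose W := \sum_(b in Y) specht_sum (rep mu Y) la (Y :\ b).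
have rMmu : {in Sym Y &, forall s t, rep mu Y (s * t)%g = rep mu Y s *m rep mu Y t}.
  by move=> s t sY tY; rewrite repr_mxM.
have /is_scalar_mxP[c Wc] : is_scalar_mx W.
  apply: (@specht_hom_scalar _ _ Y k.+1); first by rewrite -mem_parts.
  move=> h hY; rewrite /W mulmx_sumr mulmx_suml.
  rewrite (reindex_inj (@perm_inj _ h)) /=; apply: eq_big => b.
    by rewrite -{1}(imset_Sym hY) mem_imset //; apply: perm_inj.
  by move=> bY; rewrite -imset_SymD1 // -(specht_sumJ _ rMmu) // subD1set.
have cE : c = (covers la mu)%:R * (#|Sym Y|%:R / (f mu Y)%:R).
  have := congr1 mxtrace Wc; rewrite mxtrace_scalar /W linear_sum /=.
  under eq_bigr => b bY.
    have [Xk YE bX] := Yb b bY.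
    rewrite (trace_specht_sum lk mk Xk YE bX) card_Sym Xk; over.
  rewrite sumr_const Yk card_Sym Yk factS => E.
  apply: (mulIf f0'); rewrite mulrA divfK // (mulr_natr c) -E natrM.
  by rewrite -[LHS]mulr_natl mulrCA.
rewrite /specht_proj -scalemxAr /Z mulmx_suml.
transitivity (((f mu Y)%:R / #|Sym Y|%:R * c) *: specht_sum r mu Y).
  rewrite -scalerA; congr (_ *: _).
  under eq_bigr => b bY do rewrite (mul_specht_sum rM) ?subD1set // specht_sum_invE.
  rewrite exchange_big /= [in RHS]/specht_sum scaler_sumr; apply: eq_bigr => g gY.
  rewrite scalerA -scaler_suml; congr (_ *: _).
  by rewrite -linear_sum /= -mulmx_suml -/W Wc mul_scalar_mx linearZ.
rewrite cE; case: covers; rewrite ?mul0r ?mulr0 ?scale0r // mul1r.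
by rewrite mulrA divfK ?card_Sym_neq0 // divff // scale1r.
Qed.

End SpechtSums.

Section UnitaryRep.

Local Open Scope sesquilinear_scope.

Variables (R : realType) (T : finType) (d : nat).
Local Notation C := R[i].
Variable rho : mx_representation C [set: {perm T}]%G d.
Hypothesis rhoU : forall s, rho s \is unitarymx.
Implicit Types (X Y : {set T}) (la mu : seq nat).

Let rhoM s t : rho (s * t)%g = rho s *m rho t.
Proof. by rewrite repr_mxM ?inE. Qed.

Let rhoM' Y : {in Sym Y &, forall s t, rho (s * t)%g = rho s *m rho t}.
Proof. by move=> s t _ _; apply: rhoM. Qed.

Let rho_adj s : (rho s) ^t* = rho s^-1%g.
Proof. by rewrite -invmx_unitary // repr_mxV ?inE. Qed.

Lemma specht_sum_adj la X : (specht_sum rho la X) ^t* = specht_sum rho la X.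
Proof.
rewrite linear_sum map_mx_sum -[RHS]specht_sum_invE; apply: eq_bigr => s sX.
rewrite linearZ /= map_mxZ rho_adj; congr (_ *: _); exact: specht_char_conj.
Qed.

Lemma specht_proj_adj la X : (specht_proj rho la X) ^t* = specht_proj rho la X.
Proof.
rewrite linearZ /= map_mxZ specht_sum_adj; congr (_ *: _).
by apply: geC0_conj; rewrite divr_ge0 ?ler0n.
Qed.

Lemma specht_sumE k la X : la \in parts k -> #|X| = k ->
  specht_sum rho la X = (k`!%:R / (num_syt k la)%:R) *: specht_proj rho la X.
Proof.
move=> lk Xk; have := specht_rank_parts_gt0 C lk Xk.
rewrite /specht_proj (specht_complete C Xk).1 // card_Sym Xk => f0.
rewrite scalerA mulrA divfK ?divff ?scale1r ?pnatr_eq0 -?lt0n //.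
exact: fact_gt0.
Qed.

Lemma specht_proj_idem k la X : la \in parts k -> #|X| = k ->
  specht_proj rho la X *m specht_proj rho la X = specht_proj rho la X.
Proof.
by move=> lk Xk; rewrite (mul_specht_proj (@rhoM' X) Xk) // eqxx scale1r.
Qed.

Lemma specht_sum_psd k la X : la \in parts k -> #|X| = k ->
  psdmx (specht_sum rho la X).
Proof.
move=> lk Xk; rewrite (specht_sumE lk Xk); apply: psdmxZ; first by rewrite divr_ge0.
by apply: psdmx_proj; [apply: specht_proj_adj | apply: specht_proj_idem lk Xk].
Qed.

Lemma specht_sum_branch_psd k la Y y : la \in parts k -> #|Y| = k.+1 -> y \in Y ->
    {in parts k.+1, forall mu, covers la mu ->
       (2 * num_syt k.+1 mu <= k.+1 * num_syt k la)%N} ->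
  psdmx (\sum_(b in Y) specht_sum rho la (Y :\ b) - 2 *: specht_sum rho la (Y :\ y)).
Proof.
move=> lk Yk yY bal; set X := Y :\ y.
have Xk : #|X| = k by have := cardsD1 y Y; rewrite yY Yk add1n => -[].
have YE : Y = y |: X by rewrite setD1K.
have yX : y \notin X by rewrite !inE eqxx.
have XY : X \subset Y by apply: subD1set.
rewrite (sum_specht_sum_branch (@rhoM' Y) (repr_mx1 rho) lk Yk).
pose e := \sum_(mu <- parts k.+1 | covers la mu) specht_proj rho mu Y.
pose P := specht_proj rho la X.
have PP : P *m P = P by apply: specht_proj_idem lk Xk.
(* The character sum of [la] vanishes on [S^mu] unless [mu] covers [la], so only the components
   gathered in [e] survive. *)
have Pe : P *m e = P.
  rewrite -[RHS]mulmx1 -(sum_specht_proj Yk (repr_mx1 rho)) !mulmx_sumr [LHS]big_mkcond.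
  rewrite !big_seq; apply: eq_bigr => mu mk; case: ifPn => // nc.
  rewrite -scalemxAl -scalemxAr {1}/specht_sum (mul_specht_sum (@rhoM' Y)) //.
  rewrite specht_sum_invE (specht_sum_not_covers C lk mk Xk YE yX nc).
  by rewrite big1 ?scaler0 // => g _; rewrite mul0mx raddf0 scale0r.
have eA : e ^t* = e.
  by rewrite linear_sum map_mx_sum; apply: eq_bigr => mu _; rewrite /= specht_proj_adj.
have eP : e *m P = P by rewrite -eA -[P]specht_proj_adj -adjmxM Pe.
have pie mu : mu \in parts k.+1 -> covers la mu ->
    specht_proj rho mu Y *m e = specht_proj rho mu Y.
  move=> mk cm; rewrite mulmx_sumr -big_filter.
  rewrite (bigD1_seq mu) ?filter_uniq ?parts_uniq ?mem_filter ?cm //=.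
  rewrite (mul_specht_proj (@rhoM' Y) Yk) // eqxx scale1r big1_seq ?addr0 // => nu.
  rewrite mem_filter => /andP[ne /andP[_ nk]].
  by rewrite (mul_specht_proj (@rhoM' Y) Yk) // eq_sym (negPf ne) scale0r.
have ee : e *m e = e.
  rewrite {1}/e mulmx_suml big_seq_cond [RHS]big_seq_cond.
  by apply: eq_bigr => mu /andP[]; apply: pie.
have fX : num_syt k la != 0%N.
  by rewrite -(specht_complete C Xk).1 // -lt0n (specht_rank_parts_gt0 C lk Xk).
(* Twice the eigenvalue of [specht_sum rho la X] is split off each coefficient. What remains is
   nonnegative by the balance condition, and [e - P] is a projection because [P] lies below [e]. *)
have -> : \sum_(mu <- parts k.+1 | covers la mu) specht_sum rho mu Y -
    2 *: specht_sum rho la X =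
    \sum_(mu <- parts k.+1 | covers la mu)
      ((k.+1)`!%:R / (num_syt k.+1 mu)%:R - 2 * (k`!%:R / (num_syt k la)%:R)) *:
        specht_proj rho mu Y + (2 * (k`!%:R / (num_syt k la)%:R)) *: (e - P).
  under [in RHS]eq_bigr do rewrite scalerBl.
  rewrite sumrB -scaler_sumr -/e scalerBr addrA subrK.
  rewrite (specht_sumE lk Xk) scalerA; congr (_ - _).
  by rewrite big_seq_cond [RHS]big_seq_cond; apply: eq_bigr => mu /andP[mk _];
     rewrite (specht_sumE mk Yk).
apply: psdmxD.
  rewrite big_seq_cond; apply: psdmx_sum => mu /andP[mk cm]; apply: psdmxZ.
    have fY : num_syt k.+1 mu != 0%N.
      by rewrite -(specht_complete C Yk).1 // -lt0n (specht_rank_parts_gt0 C mk Yk).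
    rewrite subr_ge0 mulrA ler_pdivrMr ?ltr0n ?lt0n // mulrAC ler_pdivlMr ?ltr0n ?lt0n //.
    rewrite -!natrM ler_nat factS mulnAC mulnC [leqRHS]mulnAC [leqRHS]mulnC.
    by rewrite leq_mul2l bal ?orbT.
  by apply: psdmx_proj; [apply: specht_proj_adj | apply: specht_proj_idem mk Yk].
apply: psdmxZ; first by rewrite mulr_ge0 ?divr_ge0.
apply: psdmx_proj.
  by rewrite linearB map_mxB eA /= specht_proj_adj.
by rewrite mulmxBr !mulmxBl ee Pe eP PP subrr subr0.
Qed.

End UnitaryRep.

(* Exchanging [b] and [c] matches the pairs [c \notin X, b \in X] of the first
   sum with the pairs [c \in X, b \notin X] of the second. *)
Lemma sum_exchange (F : comNzRingType) (V : lmodType F) (T : finType) (k : nat) (b : T)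
    (v : T -> F) (E : {set T} -> V) :
  \sum_(c | c != b) \sum_(X : {set T} | [&& #|X| == k, b \in X & c \notin X])
     (v c * \prod_(a in X :\ b) v a) *: E X =
  \sum_(X : {set T} | (#|X| == k) && (b \notin X))
     (\prod_(a in X) v a) *: \sum_(c in X) E ((b |: X) :\ c).
Proof.
transitivity (\sum_(c | c != b) \sum_(X : {set T} | [&& #|X| == k, b \notin X & c \in X])
     (\prod_(a in X) v a) *: E ((b |: X) :\ c)).
  apply: eq_bigr => c cb; set s := tperm b c.
  have si : injective (fun X : {set T} => s @: X) := imset_inj (@perm_inj _ s).
  rewrite (reindex_inj si) /=.
  have sb (X : {set T}) : (b \in s @: X) = (c \in X).
    by have := mem_imset (mem X) c (@perm_inj _ s); rewrite tpermR.
  have sc (X : {set T}) : (c \in s @: X) = (b \in X).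
    by have := mem_imset (mem X) b (@perm_inj _ s); rewrite tpermL.
  apply: eq_big => X; rewrite card_imset ?sb ?sc; try exact: perm_inj.
    by rewrite [(c \in X) && _]andbC.
  case/and3P=> _ cX bX.
  have sX : s @: X = (b |: X) :\ c.
    apply/setP=> x; rewrite !inE; apply/imsetP/andP => [[z zX ->]|[xc]].
      case: tpermP => [zb|_|zb zc]; first by rewrite -zb zX in bX.
        by rewrite eq_sym cb eqxx.
      by rewrite zX orbT; split=> //; apply/eqP.
    case/orP=> [/eqP ->|xX]; first by exists c; rewrite ?tpermR.
    exists x => //; rewrite tpermD // eq_sym //.
    by apply: contraNneq bX => <-.
  rewrite sX; congr (_ *: _); rewrite [RHS](big_setD1 c) //=; congr (_ * _).
  apply: eq_bigl => x; rewrite !inE.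
  by case: (eqVneq x b) => [->|]; rewrite ?(negPf bX) ?andbF //=.
rewrite (exchange_big_dep (fun X : {set T} => (#|X| == k) && (b \notin X))) /=;
  last first.
  by move=> c X _ /and3P[-> ->].
apply: eq_bigr => X /andP[Xk bX]; rewrite scaler_sumr; apply: eq_bigl => c.
rewrite Xk bX /=; case cX: (c \in X); last by rewrite andbF.
by rewrite andbT; apply: contraNneq bX => <-.
Qed.

(** * Weighted sums with at most one negative weight *)

Section Weighted.

Variables (R : realType) (T : finType) (d k : nat) (E : {set T} -> 'M[R[i]]_d).
Hypothesis E_psd : forall X : {set T}, #|X| = k -> psdmx (E X).

Lemma psdmx_weighted_nonneg (u : T -> R[i]) : (forall c, 0 <= u c) ->
  psdmx (\sum_(X : {set T} | #|X| == k) (\prod_(a in ~: X) u a) *: E X).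
Proof.
move=> u0; apply: psdmx_sum => X /eqP Xk.
by apply: psdmxZ; [apply: prodr_ge0 | apply: E_psd].
Qed.

Hypothesis E_branch : forall (Y : {set T}) y, #|Y| = k.+1 -> y \in Y ->
  psdmx (\sum_(c in Y) E (Y :\ c) - 2 *: E (Y :\ y)).

Lemma psdmx_weighted_neg (u : T -> R[i]) (b : T) :
    (forall c, c != b -> 0 < u c) -> u b < 0 -> \sum_c (u c)^-1 <= 0 ->
  psdmx (\sum_(X : {set T} | #|X| == k) (\prod_(a in ~: X) u a) *: E X).
Proof.
move=> u0 ub us; pose v c := (u c)^-1; pose w := - u b.
pose U := \prod_(c | c != b) u c; pose V := \sum_(c | c != b) v c.
have w0 : 0 < w by rewrite oppr_gt0.
have U0 : 0 < U by apply: prodr_gt0.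
have v0 c : c != b -> 0 < v c by move=> cb; rewrite invr_gt0 u0.
have wV : w * V <= 1.
  have : V <= w^-1.
    by move: us; rewrite (bigD1 b) //= -/V /w invrN addrC -lerBrDr sub0r.
  by rewrite -(ler_pM2l w0) mulfV ?gt_eqF.
have vX0 (X : {set T}) : b \notin X -> 0 <= \prod_(a in X) v a.
  by move=> bX; apply: prodr_ge0 => a aX; apply/ltW/v0; apply: contraNneq bX => <-.
have UvE (Z : {set T}) : b \notin Z ->
    \prod_(a in ~: (b |: Z)) u a = U * \prod_(a in Z) v a.
  move=> bZ; rewrite prodfV /U [X in _ = X * _](bigID (mem Z)) /= mulrAC.
  rewrite [X in X * _ * _](eq_bigl (mem Z)) => [|a]; last first.
    case: (eqVneq a b) => [->|_] //=.
    exact/esym/negbTE.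
  rewrite mulfV ?mul1r; last first.
    by rewrite gt_eqF // prodr_gt0 // => a aZ; apply: u0; apply: contraNneq bZ => <-.
  by apply: eq_bigl => a; rewrite !inE negb_or.
pose A := \sum_(X : {set T} | (#|X| == k) && (b \in X)) (\prod_(a in X :\ b) v a) *: E X.
pose B := \sum_(X : {set T} | (#|X| == k) && (b \notin X)) (\prod_(a in X) v a) *: E X.
have -> : \sum_(X : {set T} | #|X| == k) (\prod_(a in ~: X) u a) *: E X =
    U *: (A - w *: B).
  rewrite (bigID (fun X : {set T} => b \in X)) /= scalerBr; congr (_ + _).
    rewrite scaler_sumr; apply: eq_bigr => X /andP[_ bX].
    by rewrite scalerA -UvE ?setD1K // !inE eqxx.
  rewrite -scalerN -scaleNr opprK scalerA scaler_sumr; apply: eq_bigr => X /andP[_ bX].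
  rewrite scalerA (bigD1 b) ?inE //= mulrAC -UvE // mulrC; congr (_ * _ *: _).
  by apply: eq_bigl => a; rewrite !inE negb_or andbC.
apply: psdmxZ; first exact: ltW.
have A_psd : psdmx A.
  apply: psdmx_sum => X /andP[/eqP Xk bX]; apply: psdmxZ; last exact: E_psd.
  by apply: vX0; rewrite !inE eqxx.
(* Since [w * V <= 1], the first term is positive and only [V *: A - B] is left to treat. *)
have -> : A - w *: B = (1 - w * V) *: A + w *: (V *: A - B).
  by rewrite scalerBr scalerBl scale1r scalerA addrA subrK.
apply: psdmxD; first by apply: psdmxZ; rewrite ?subr_ge0.
apply: psdmxZ; first exact: ltW.
(* In [V *: A], the terms with [c] in [X] are positive as they stand; those with [c] outside [X] are
   exchanged so as to carry the monomials of [B]. *)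
have -> : V *: A - B =
    \sum_(c | c != b) \sum_(X : {set T} | [&& #|X| == k, b \in X & c \in X])
      (v c * \prod_(a in X :\ b) v a) *: E X +
    \sum_(X : {set T} | (#|X| == k) && (b \notin X)) (\prod_(a in X) v a) *:
      (\sum_(c in X) E ((b |: X) :\ c) - E X).
  under [X in _ = _ + X]eq_bigr do rewrite scalerBr.
  rewrite sumrB addrA -/B; congr (_ - _).
  rewrite -sum_exchange -big_split scaler_suml /=; apply: eq_bigr => c cb.
  rewrite scaler_sumr (bigID (fun X : {set T} => c \in X)) /=; congr (_ + _).
    by apply: eq_big => [X|X _]; rewrite ?andbA ?scalerA.
  by apply: eq_big => [X|X _]; rewrite ?andbA ?scalerA.
apply: psdmxD.
  apply: psdmx_sum => c cb; apply: psdmx_sum => X /and3P[/eqP Xk bX cX].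
  apply: psdmxZ; last exact: E_psd.
  by rewrite mulr_ge0 ?vX0 ?inE ?eqxx // ltW ?v0.
apply: psdmx_sum => X /andP[/eqP Xk bX]; apply: psdmxZ; first exact: vX0.
have Yk : #|b |: X| = k.+1 by rewrite cardsU1 bX Xk.
have := E_branch Yk (setU11 b X); rewrite (big_setU1 _ bX) /= setU1K //.
by rewrite scaler_nat mulr2n opprD addrA [E X + _]addrC addrK.
Qed.

End Weighted.

(** * Plücker coordinates as operators *)

Section Plucker.

Variables (R : realType) (n : nat).
Local Notation C := R[i].
Local Notation G := [set: 'S_n]%G.

Definition plucker_coef la (u : 'I_n -> C) (s : 'S_n) : C :=
  \sum_(X : {set 'I_n} | #|X| == sumn la)
     (\prod_(a in ~: X) u a) * ((s \in Sym X)%:R * specht_char C la X s).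

Lemma pluckerE la (u : 'I_n -> C) :
  plucker la u = \sum_s plucker_coef la u s *: regular_repr C G s.
Proof.
rewrite /plucker /plucker_coef; under [RHS]eq_bigr do rewrite scaler_suml.
rewrite exchange_big /=; apply: eq_bigr => X _; rewrite scaler_sumr big_mkcond /=.
apply: eq_bigr => s _; case: ifP => _; last by rewrite mul0r mulr0 scale0r.
by rewrite mul1r scalerA.
Qed.

Lemma gring_coefE (a : 'S_n -> C) s :
  gring_coef (\sum_t a t *: regular_repr C G t) s = a s.
Proof.
rewrite /gring_coef linear_sum summxE (bigD1 s) //= big1 ?addr0 => [|t ts].
  by rewrite linearZ /= gring_projE ?inE // eqxx mulr1n !mxE eqxx mulr1.
by rewrite linearZ /= gring_projE ?inE // eq_sym (negPf ts) scaler0 mxE.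
Qed.

Lemma gring_star_sum (a : 'S_n -> C) : (forall s, a s^-1%g = (a s)^*) ->
  gring_star (\sum_s a s *: regular_repr C G s) = \sum_s a s *: regular_repr C G s.
Proof.
move=> aV; rewrite /gring_star [RHS](reindex_inj invg_inj) /=.
by apply: eq_bigr => s _; rewrite gring_coefE aV.
Qed.

Lemma plucker_star la (u : 'I_n -> C) : (forall c, (u c)^* = u c) ->
  gring_star (plucker la u) = plucker la u.
Proof.
move=> ur; rewrite pluckerE gring_star_sum // => s.
rewrite rmorph_sum; apply: eq_bigr => X _; rewrite 2!rmorphM /= rmorph_nat rmorph_prod.
congr (_ * _); first by apply: eq_bigr => a _; rewrite -[LHS]ur.
rewrite groupV; case sX: (s \in Sym X); rewrite ?mul0r // !mul1r.
exact: conj_specht_charV.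
Qed.

Lemma gring_op_plucker la (u : 'I_n -> C) d (rho : mx_representation C G d) :
  gring_op rho (plucker la u) =
  \sum_(X : {set 'I_n} | #|X| == sumn la)
     (\prod_(a in ~: X) u a) *: specht_sum rho la X.
Proof.
rewrite linear_sum; apply: eq_bigr => X _; rewrite linearZ linear_sum; congr (_ *: _).
by apply: eq_bigr => s _; rewrite linearZ /= gring_opG ?inE.
Qed.

End Plucker.

Lemma specht_dimE (C : numClosedFieldType) k la : la \in parts k ->
  specht_dim C la = num_syt k la.
Proof.
move=> lk; have /and3P[_ _ /eqP sk] : is_partition_of k la by rewrite -mem_parts.
by rewrite /specht_dim (@specht_complete C _ k _ _).1 // cardsT card_ord.
Qed.

Section Theta.

Variable R : realType.

Lemma num_syt_gt0 k la : la \in parts k -> (0 < num_syt k la)%N.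
Proof.
move=> lk; rewrite -(specht_dimE R[i] lk).
by apply: (@specht_rank_parts_gt0 _ _ k) => //; rewrite cardsT card_ord;
  move: lk; rewrite mem_parts => /and3P[_ _ /eqP].
Qed.

Lemma branching_balanced_leq k la mu : la \in parts k -> branching_balanced R la ->
  mu \in parts k.+1 -> covers la mu -> (2 * num_syt k.+1 mu <= k.+1 * num_syt k la)%N.
Proof.
move=> lk bal mk; case/hasP=> j; rewrite mem_iota /= add0n => ilt /eqP muE.
have sk : sumn la = k by move: lk; rewrite mem_parts => /and3P[_ _ /eqP].
have : p_up R la mu <= 2^-1.
  apply: le_trans bal; rewrite muE /theta.
  apply: (le_bigmax_cond _
    (fun i : 'I_(size la).+1 => p_up R la (incr_nth la i)) (j := Ordinal ilt)).
  by rewrite /= sk -muE -mem_parts.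
rewrite /p_up (specht_dimE _ lk) (specht_dimE _ mk) sk.
have f0 := num_syt_gt0 lk.
rewrite -natrM ler_pdivrMr ?ltr0n ?muln_gt0 // mulrC ler_pdivlMr ?ltr0n //.
by rewrite -natrM ler_nat mulnC.
Qed.

(** Both shapes above a single box have one standard tableau, so each transition probability is
    exactly one half. *)
Lemma branching_balanced1 : branching_balanced R [:: 1%N].
Proof.
apply: bigmax_le => [|i]; first by rewrite invr_ge0.
have p0 : parts 0 = [:: [::]] by [].
have p1 : parts 1 = [:: [:: 1%N]] by [].
have n1 : num_syt 1 [:: 1%N] = 1%N by rewrite num_sytS p0 big_cons big_nil.
rewrite -mem_parts => mk; rewrite /p_up.
rewrite (specht_dimE _ mk) (@specht_dimE _ 1) ?p1 // n1 mulr1.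
rewrite ler_pdivrMr ?ltr0n // mulVf ?pnatr_eq0 // (ler_nat _ _ 1).
rewrite num_sytS p1 big_cons big_nil n1; by case: ifP.
Qed.

End Theta.

Local Open Scope complex_scope.

(** * The sum of inverses between the last two roots *)

Section Poles.

Variables (R : realFieldType) (I : finType) (r : I -> R).

(** The logarithmic derivative: away from its roots, the product times this sum is the
    derivative. *)
Lemma root_deriv_prod (x : R) : (forall c, x != r c) ->
  root (\prod_c ('X - (r c)%:P))^`() x -> \sum_c (x - r c)^-1 = 0.
Proof.
move=> xr; have xr' c : x - r c != 0 by rewrite subr_eq0.
have E (s : seq I) : (\prod_(c <- s) ('X - (r c)%:P))^`().[x] =
    (\prod_(c <- s) (x - r c)) * \sum_(c <- s) (x - r c)^-1.
  elim: s => [|c s IH]; first by rewrite !big_nil derivC horner0 mulr0.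
  rewrite !big_cons derivM derivXsubC mul1r hornerD hornerM IH horner_prod.
  under eq_bigr do rewrite hornerXsubC.
  by rewrite hornerXsubC mulrDr mulrAC mulfV // mul1r mulrA.
rewrite /root E mulf_eq0 => /orP[|/eqP //].
by rewrite prodf_seq_eq0 => /hasP[c _ /=]; rewrite (negPf (xr' c)).
Qed.

(** Every summand decreases, as no pole is crossed: the one at [b] stays negative and the others
    stay positive. *)
Lemma sum_inv_le (b : I) (x y : R) :
    (forall c, c != b -> r c < x) -> x <= y -> y < r b ->
  \sum_c (y - r c)^-1 <= \sum_c (x - r c)^-1.
Proof.
move=> rx xy yb; apply: ler_sum => c _; case: (eqVneq c b) => [->|cb].
  by rewrite lef_nV2 ?negrE ?subr_lt0 ?lerB // (le_lt_trans xy).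
have h := rx c cb.
by rewrite lef_pV2 ?posrE ?subr_gt0 ?lerB // (lt_le_trans h).
Qed.

Lemma sum_inv_lt (b : I) (x y : R) :
    (forall c, c != b -> r c < x) -> x < y -> y < r b ->
  \sum_c (y - r c)^-1 < \sum_c (x - r c)^-1.
Proof.
move=> rx xy yb; rewrite (bigD1 b) //= [ltRHS](bigD1 b) //=.
apply: ltr_leD.
  by rewrite ltf_nV2 ?negrE ?subr_lt0 ?ltrD2r // (lt_trans xy).
apply: ler_sum => c cb; have h := rx c cb.
by rewrite lef_pV2 ?posrE ?subr_gt0 ?lerB ?(ltW xy) // (lt_trans h).
Qed.

End Poles.

Section Plucker.

Variables (R : realType) (n : nat).
Local Notation C := R[i].

Lemma conj_real_complex (x : R) : (x%:C)^*%R = x%:C.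
Proof. by apply/CrealP/complex_realP; exists x. Qed.

Lemma plucker_psd (la : seq nat) (u : 'I_n -> R) :
    (forall (d : nat) (rho : mx_representation C [set: 'S_n]%G d),
       (forall s, rho s \is unitarymx) ->
     psdmx (\sum_(X : {set 'I_n} | #|X| == sumn la)
              (\prod_(a in ~: X) (u a)%:C) *: specht_sum rho la X)) ->
  gring_psd (plucker la (fun c => (u c)%:C)).
Proof.
move=> H; split; first by apply: plucker_star => c; apply: conj_real_complex.
by move=> d rho rhoU; rewrite gring_op_plucker; apply: H.
Qed.

Lemma plucker_psd_nonneg k (la : seq nat) (u : 'I_n -> R) :
    la \in parts k -> (forall c, 0 <= u c) ->
  gring_psd (plucker la (fun c => (u c)%:C)).
Proof.
move=> lk u0; have sk : sumn la = k by move: lk; rewrite mem_parts => /and3P[_ _ /eqP].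
apply: plucker_psd => d rho rhoU; rewrite sk.
apply: psdmx_weighted_nonneg => [X Xk|c]; first exact: specht_sum_psd lk Xk.
by rewrite lecR.
Qed.

Lemma plucker_psd_neg k (la : seq nat) (u : 'I_n -> R) (b : 'I_n) :
    la \in parts k -> branching_balanced R la ->
    (forall c, c != b -> 0 < u c) -> u b < 0 -> \sum_c (u c)^-1 <= 0 ->
  gring_psd (plucker la (fun c => (u c)%:C)).
Proof.
move=> lk bal u0 ub us.
have sk : sumn la = k by move: lk; rewrite mem_parts => /and3P[_ _ /eqP].
apply: plucker_psd => d rho rhoU; rewrite sk.
apply: (@psdmx_weighted_neg _ _ _ _ _ _ _ _ b).
- by move=> X Xk; apply: specht_sum_psd lk Xk.
- move=> Y y Yk yY; apply: (specht_sum_branch_psd rhoU lk Yk yY) => mu mk.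
  exact: branching_balanced_leq lk bal mk.
- by move=> c cb; rewrite ltcR u0.
- by rewrite ltcR.
under eq_bigr do rewrite -fmorphV.
by rewrite -rmorph_sum lecR.
Qed.

(** The trivial representation is a sufficient test: there the operator is the product of the [u c],
    which is negative, times the positive sum of their inverses. *)
Lemma plucker1_not_psd (u : 'I_n -> R) (b : 'I_n) :
    (forall c, c != b -> 0 < u c) -> u b < 0 -> 0 < \sum_c (u c)^-1 ->
  ~ gring_psd (plucker [:: 1%N] (fun c => (u c)%:C)).
Proof.
move=> u0 ub us [_ H].
have triv_repr : mx_repr [set: 'S_n]%G (fun _ => 1%:M : 'M[C]_1).
  by split=> // s t _ _; rewrite mulmx1.
pose rho := MxRepresentation triv_repr.
have rhoU s : rho s \is unitarymx.
  by apply/unitarymxP; rewrite /= trmx1 map_mx1 mulmx1.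
have pu : \prod_c u c < 0.
  by rewrite (bigD1 b) //= nmulr_rlt0 // prodr_gt0.
have [_ /(_ 1%:M)] := H 1%N rho rhoU.
rewrite gring_op_plucker trmx1 map_mx1 mul1mx mulmx1.
rewrite (eq_bigl (mem (set1 @: [set: 'I_n]))) => [|X]; last first.
  by rewrite -[RHS]/(X \in _); apply/cards1P/imsetP => [[x ->]|[x _ ->]]; exists x.
rewrite big_imset => [|x y _ _ /set1_inj //] /=.
rewrite (eq_bigr (fun x => ((\prod_c u c) * (u x)^-1)%:C *: 1%:M)) => [|x _].
  rewrite -scaler_suml mxE mxE mulr1 -rmorph_sum /= lecR -mulr_sumr.
  by apply/negP; rewrite -ltNge nmulr_rlt0 //; under eq_bigl do rewrite inE.
have ux : u x != 0.
  by case: (eqVneq x b) => [->|/u0 /gt_eqF ->//]; rewrite lt_eqF.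
have -> : (\prod_c u c) * (u x)^-1 = \prod_(c in ~: [set x]) u c.
  rewrite (bigD1 x) //= mulrAC mulfV // mul1r.
  by apply: eq_bigl => c; rewrite !inE.
rewrite rmorph_prod; congr (_ *: _).
have cx : #|[set x]| = 1%N by apply: cards1.
have /eqP S1 : Sym [set x] == 1%g by rewrite trivg_card1 card_Sym cx.
rewrite /specht_sum S1 big_set1 specht_char1 (specht_complete C cx).1 //.
by rewrite num_sytS (_ : parts 0 = [:: [::]]) // big_cons big_nil scale1r.
Qed.

End Plucker.

Theorem corollary3p2 (R : realType) (n : nat) (hn : (2 <= n)%N)
  (r : 'I_n -> R) (hr : forall a b : 'I_n, (a < b)%N -> r a < r b)
  (xi : R) (hxi : largest_root (\prod_(c < n) ('X - (r c)%:P))^`() xi)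
  (a b : 'I_n) (ha : a.+2 = n) (hb : b.+1 = n) (hab : r a < xi < r b) :
  (forall (k : nat) (la : seq nat),
      (1 <= k <= n)%N -> is_partition_of k la -> branching_balanced R la ->
      forall t : R, xi <= t ->
        gring_psd (plucker la (fun c : 'I_n => (t - r c)%:C)))
  /\
  (forall eta : R, eta < xi ->
      exists (k : nat) (la : seq nat),
        [/\ (1 <= k <= n)%N, is_partition_of k la, branching_balanced R la &
            ~ (forall t : R, eta <= t ->
                 gring_psd (plucker la (fun c : 'I_n => (t - r c)%:C)))]).
Proof.
case/andP: hab => axi xib.
have r_le (c : 'I_n) (d : 'I_n) : (c <= d)%N -> r c <= r d.
  rewrite leq_eqVlt => /orP[/eqP/val_inj ->//|/hr]; exact: ltW.
have ra c : c != b -> r c <= r a.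
  move=> cb; apply: r_le; have := ltn_ord c.
  by have : (c != b :> nat) := cb; lia.
have xi_r c : xi != r c.
  case: (eqVneq c b) => [->|/ra ca]; first by rewrite lt_eqF.
  by rewrite gt_eqF // (le_lt_trans ca).
have xi0 := root_deriv_prod xi_r hxi.1.
split=> [k la k1n pl bal t xit|eta etaxi].
  (* The point [t = r b] belongs to the nonnegative case: its weight is 0, for which the criterion
     with inverses would be meaningless. *)
  rewrite -mem_parts in pl; case: (leP (r b) t) => tb.
    apply: plucker_psd_nonneg pl _ => c; rewrite subr_ge0 (le_trans _ tb) // r_le //.
    by rewrite -ltnS hb.
  apply: (plucker_psd_neg pl bal (b := b)) => [c /ra ca||].
  - by rewrite subr_gt0 (le_lt_trans ca) // (lt_le_trans axi).
  - by rewrite subr_lt0.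
  rewrite -[leRHS]xi0; apply: (sum_inv_le (b := b)) => // c /ra ca.
  exact: le_lt_trans axi.
exists 1%N, [:: 1%N]; split=> //; [by rewrite (ltnW hn) | exact: branching_balanced1 |].
(* The midpoint keeps [t] strictly between [r a] and [xi], so that only the weight at [b] is
   negative; the maximum keeps it in the prescribed range. *)
pose t := Num.max eta ((r a + xi) / 2).
have txi : t < xi by rewrite gt_max etaxi /=; lra.
have at_ : r a < t by rewrite lt_max; apply/orP; right; lra.
move/(_ t); rewrite le_max lexx => /(_ isT).
apply: (plucker1_not_psd (b := b)) => [c /ra ca||].
- by rewrite subr_gt0 (le_lt_trans ca).
- by rewrite subr_lt0 (lt_trans txi).
rewrite -[ltLHS]xi0; apply: (sum_inv_lt (b := b)) => // c /ra ca.
exact: le_lt_trans at_.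
Qed.
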